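(* Let $x^*$ be a stationary point of the nonlinear semidefinite program $\min\{f(x): h(x)=0,\ g(x)\in\mathcal{S}^p_+\}$ with $(\lambda^*,\mu^* )\in\mathcal{M}(x^* )$. Suppose that the constraint nondegeneracy condition $$\begin{pmatrix}\mathcal{J}h(x^* )\\ \mathcal{J}g(x^* )\end{pmatrix}\mathcal{X}+\begin{pmatrix}\{0\}\\ \mathrm{lin}(\mathcal{T}_{\mathcal{S}^p_+}(g(x^* )))\end{pmatrix}=\begin{pmatrix}\mathbb{R}^m\\ \mathcal{S}^p\end{pmatrix}$$ and the strong second-order sufficient condition $$\sup_{(\lambda,\mu)\in\mathcal{M}(x^* )}\Big\{\langle d,\nabla^2_{xx}\mathcal{L}_0(x^*,\lambda,\mu)d\rangle-\Upsilon_{g(x^* )}(\mu,\mathcal{J}g(x^* )d)\Big\}>0\qquad\forall d\in\widehat{\mathcal{C}}(x^* )\setminus\{0\}$$ hold. Then: (i) $(\lambda^*,\mu^* )$ is the unique element of $\mathcal{M}(x^* )$; (ii) there exist constants $\bar c>0$ and $\eta>0$ such that for any $c\ge\bar c$, $\langle x,\mathcal{A}_{(c,\lambda^*,\mu^* )}(W)x\rangle\ge\eta\|x\|^2$ for all $W\in\partial_B\Pi_{\mathcal{S}^p_+}(\mu^*-cg(x^* ))$ and all $x\in\mathcal{X}$; (iii) for any $c\ge\bar c$, every $V\in\mathbb{V}_c(\lambda^*,\mu^* )$ satisfies $V\prec0$ (is negative definite).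
   Context: Setting. $\mathcal{X}$ is a finite-dimensional real Hilbert space; $\mathcal{S}^p$ is the space of $p\times p$ real symmetric matrices with inner product $\langle Z,Z'\rangle=\mathrm{Tr}(Z^TZ')$ and $\mathcal{S}^p_+$ the cone of positive semidefinite matrices. $f:\mathcal{X}\to\mathbb{R}$, $h:\mathcal{X}\to\mathbb{R}^m$, $g:\mathcal{X}\to\mathcal{S}^p$ are twice continuously differentiable. $\mathcal{J}$ denotes the Fréchet derivative, $\nabla$ its adjoint. $\Pi_{\mathcal{S}^p_+}$ is the metric projection. For a locally Lipschitz $F$, differentiable on $D_F$, $\partial_BF(u)=\{\lim_k\mathcal{J}F(u^k):u^k\in D_F,\ u^k\to u\}$. $\mathcal{T}_{\mathcal{S}^p_+}(Z)$ is the tangent cone of $\mathcal{S}^p_+$ at $Z$, and $\mathrm{lin}\,U$ is the lineality space (largest linear subspace contained in $U$). $\mathcal{L}_0(x,\lambda,\mu)=f(x)-\langle\lambda,h(x)\rangle-\langle\mu,g(x)\rangle$. $\mathcal{M}(x)$ is the set of $(\lambda,\mu)\in\mathbb{R}^m\times\mathcal{S}^p$ with $\nabla_x\mathcal{L}_0(x,\lambda,\mu)=0$, $h(x)=0$, $g(x)\in\mathcal{S}^p_+$, $\mu\in\mathcal{S}^p_+$, $\langle\mu,g(x)\rangle=0$; $x$ is stationary if $\mathcal{M}(x)\ne\emptyset$. For $(\lambda,\mu)\in\mathcal{M}(x^* )$, let $g(x^* )-\mu=PDP^T$ be a spectral decomposition with $P$ orthogonal and $D$ diagonal with non-increasing diagonal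 entries $\varrho_1\ge\dots\ge\varrho_p$; let $\alpha,\beta,\gamma$ be the index sets of positive, zero and negative eigenvalues, and partition the columns $P=(P_\alpha,P_\beta,P_\gamma)$ accordingly. Define $$\mathrm{app}(\lambda,\mu)=\{d\in\mathcal{X}:\mathcal{J}h(x^* )d=0,\ P_\beta^T(\mathcal{J}g(x^* )d)P_\gamma=0,\ P_\gamma^T(\mathcal{J}g(x^* )d)P_\gamma=0\},\qquad \widehat{\mathcal{C}}(x^* )=\bigcap_{(\lambda,\mu)\in\mathcal{M}(x^* )}\mathrm{app}(\lambda,\mu).$$ For $B\in\mathcal{S}^p$, $\Upsilon_B(\Gamma,A)=2\langle\Gamma,AB^\dagger A\rangle$ for $(\Gamma,A)\in\mathcal{S}^p\times\mathcal{S}^p$, where $B^\dagger$ is the Moore–Penrose pseudo-inverse. For $c>0$ and a linear operator $W$ on $\mathcal{S}^p$: $\mathcal{A}_{(c,\lambda^*,\mu^* )}(W)=\nabla^2_{xx}\mathcal{L}_0(x^*,\lambda^*,\mu^* )+c\nabla h(x^* )\mathcal{J}h(x^* )+c\nabla g(x^* )W\mathcal{J}g(x^* )$, and $$\mathbb{V}_c(\lambda^*,\mu^* )=\Big\{-\begin{pmatrix}\mathcal{J}h(x^* )\\ W\mathcal{J}g(x^* )\end{pmatrix}\mathcal{A}_{(c,\lambda^*,\mu^* )}(W)^{-1}\big(\nabla h(x^* ),\nabla g(x^* )W\big)-\begin{pmatrix}0&0\\0&\frac1c(\mathcal{I}-W)\end{pmatrix}:W\in\partial_B\Pi_{\mathcal{S}^p_+}(\mu^*-cg(x^*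 ))\Big\},$$ a set of linear operators on $\mathbb{R}^m\times\mathcal{S}^p$ ($\mathcal{I}$ the identity on $\mathcal{S}^p$), well defined for $c\ge\bar c$ by (ii). *)

(* Defs.v *)
From HB Require Import structures.
From mathcomp Require Import all_boot all_order all_algebra.
From mathcomp Require Import boolp classical_sets functions reals ereal.
From mathcomp Require Import topology normedtype sequences derive.

Set Implicit Arguments.
Unset Strict Implicit.
Unset Printing Implicit Defensive.

Import Order.TTheory GRing.Theory Num.Theory.
Import numFieldNormedType.Exports.

Local Open Scope ring_scope.
Local Open Scope classical_set_scope.

HB.mixin Record hasInner (R : realType) V & Vector R V := {
  inner : V -> V -> R;
  innerC : forall x y, inner x y = inner y x;
  inner_linearl : forall (a : R) x y z,
    inner (a *: x + y) z = a * inner x z + inner y z;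
  inner_gt0 : forall x, x != 0 -> 0 < inner x x
}.

#[short(type="innerVectType")]
HB.structure Definition InnerVect (R : realType) :=
  {V of hasInner R V & Vector R V}.

Notation "'<< x , y >>" := (inner x y) (at level 0, x at level 99,
  y at level 99, format "''<<' x ,  y '>>'") : ring_scope.

(* Completeness is automatic in finite dimension. *)
HB.mixin Record isHilbert (R : realType) V
    & InnerVect R V & NormedModule R V := {
  normr_inner : forall x : V, `|x| ^+ 2 = inner x x
}.

#[short(type="hilbertVectType")]
HB.structure Definition HilbertVect (R : realType) :=
  {V of isHilbert R V & InnerVect R V & NormedModule R V}.

Section InnerTheory.
Context {R : realType} {V : innerVectType R}.
Implicit Types x y : V.

Definition inner_norm x : R := Num.sqrt '<<x, x>>.

Lemma innerDl x y z : '<<x + y, z>> = '<<x, z>> + '<<y, z>>.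
Proof. by have := inner_linearl 1 x y z; rewrite scale1r mul1r. Qed.

Lemma inner0l y : '<<0, y>> = 0.
Proof.
by apply: (@addrI _ '<<0, y>>); rewrite -innerDl !addr0.
Qed.

Lemma innerZl a x y : '<<a *: x, y>> = a * '<<x, y>>.
Proof. by have := inner_linearl a x 0 y; rewrite inner0l !addr0. Qed.

Lemma innerDr x y z : '<<z, x + y>> = '<<z, x>> + '<<z, y>>.
Proof. by rewrite innerC innerDl !(innerC z). Qed.

Lemma innerZr a x y : '<<x, a *: y>> = a * '<<x, y>>.
Proof. by rewrite innerC innerZl innerC. Qed.

Lemma inner_pos x : x != 0 -> 0 < '<<x, x>>.
Proof. exact: (@inner_gt0 R V x). Qed.

Lemma inner_ge0 x : 0 <= '<<x, x>>.
Proof. by have [->|/inner_pos/ltW//] := eqVneq x 0; rewrite inner0l. Qed.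

Lemma inner_norm_eq0 x : inner_norm x = 0 -> x = 0.
Proof.
move=> /eqP; rewrite sqrtr_eq0; have [//|/inner_pos x0] := eqVneq x 0.
by rewrite leNgt x0.
Qed.

Lemma inner_normZ a x : inner_norm (a *: x) = `|a| * inner_norm x.
Proof.
rewrite /inner_norm innerZl innerZr mulrA -expr2 sqrtrM ?sqr_ge0//.
by rewrite sqrtr_sqr.
Qed.

Lemma inner_CS x y : '<<x, y>> <= inner_norm x * inner_norm y.
Proof.
have [->|y0] := eqVneq y 0.
  by rewrite innerC inner0l mulr_ge0 ?sqrtr_ge0.
have yy := inner_pos y0; set t := '<<x, y>> / '<<y, y>>.
have := inner_ge0 (x + (- t) *: y).
rewrite innerDl !innerDr !innerZl !innerZr (innerC y x) => H.
have {}H : '<<x, y>> ^+ 2 <= '<<x, x>> * '<<y, y>>.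
  rewrite -ler_pdivrMr// expr2 mulrAC -/t.
  have e : t * '<<y, y>> = '<<x, y>> by rewrite /t divfK// gt_eqF.
  by move: H; rewrite !mulNr mulrN opprK e addNr addr0 subr_ge0.
apply: le_trans (ler_norm _) _.
by rewrite -sqrtr_sqr /inner_norm -sqrtrM ?inner_ge0// ler_wsqrtr.
Qed.

Lemma inner_normD x y : inner_norm (x + y) <= inner_norm x + inner_norm y.
Proof.
rewrite -(@ler_pXn2r _ 2)// ?nnegrE ?addr_ge0 ?sqrtr_ge0//.
rewrite sqrrD !sqr_sqrtr ?inner_ge0// innerDl !innerDr (innerC y x).
rewrite addrA lerD2r -addrA lerD2l -mulr2n.
by rewrite lerMn2r inner_CS orbT.
Qed.

Lemma inner_norm_sqr x : inner_norm x ^+ 2 = '<<x, x>>.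
Proof. by rewrite sqr_sqrtr ?inner_ge0. Qed.

End InnerTheory.

(* Plain matrices carry the max norm, hence this alias of 'cV with the
   Euclidean one. *)

Definition evec (R : realType) (m : nat) : Type := 'cV[R]_m.

Section Evec.
Variables (R : realType) (m : nat).
Local Notation E := (evec R m).

HB.instance Definition _ := Vector.copy E 'cV[R]_m.

Definition evec_inner (x y : E) : R := \sum_(i < m) x i 0 * y i 0.

Let evec_innerC x y : evec_inner x y = evec_inner y x.
Proof. by apply: eq_bigr => i _; rewrite mulrC. Qed.

Let evec_inner_linear (a : R) (x y z : E) :
  evec_inner (a *: x + y) z = a * evec_inner x z + evec_inner y z.
Proof.
rewrite /evec_inner mulr_sumr -big_split; apply: eq_bigr => i _ /=.
by rewrite !mxE mulrDl mulrA.
Qed.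

Let evec_inner_gt0 (x : E) : x != 0 -> 0 < evec_inner x x.
Proof.
move=> x0; rewrite lt_neqAle eq_sym sumr_ge0 ?andbT; last first.
  by move=> i _; rewrite -expr2 sqr_ge0.
apply: contra x0 => /eqP x0; apply/eqP/colP => i; rewrite mxE.
apply/eqP; rewrite -sqrf_eq0 expr2; apply/eqP.
by apply: (psumr_eq0P _ x0) => // j _; rewrite -expr2 sqr_ge0.
Qed.

HB.instance Definition _ :=
  hasInner.Build R E evec_innerC evec_inner_linear evec_inner_gt0.
HB.instance Definition _ := @Lmodule_isNormed.Build R E
  inner_norm inner_normD inner_normZ inner_norm_eq0.
HB.instance Definition _ := isHilbert.Build R E inner_norm_sqr.

End Evec.

Definition symspace (R : realType) (p : nat) : {vspace 'M[R]_p} :=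
  lker (linfun (fun A : 'M[R]_p => A - A^T)).

Definition symmx (R : realType) (p : nat) : Type := subvs_of (symspace R p).

Section Symmx.
Variables (R : realType) (p : nat).
Local Notation S := (symmx R p).

HB.instance Definition _ := Vector.copy S (subvs_of (symspace R p)).

Definition mx_of_sym (Z : S) : 'M[R]_p := vsval Z.

Fact mx_of_sym_is_linear : linear mx_of_sym.
Proof. exact: (linearP (@vsval _ _ (symspace R p))). Qed.

HB.instance Definition _ :=
  GRing.isLinear.Build R S 'M[R]_p *:%R mx_of_sym mx_of_sym_is_linear.

Lemma mx_of_sym_inj : injective mx_of_sym.
Proof. exact: subvs_inj. Qed.

Definition sym_inner (Z Z' : S) : R := \tr ((mx_of_sym Z)^T *m mx_of_sym Z').

Let sym_innerC x y : sym_inner x y = sym_inner y x.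
Proof. by rewrite /sym_inner -mxtrace_tr trmx_mul trmxK. Qed.

Let sym_inner_linear (a : R) (x y z : S) :
  sym_inner (a *: x + y) z = a * sym_inner x z + sym_inner y z.
Proof.
rewrite /sym_inner mx_of_sym_is_linear linearD linearZ mulmxDl -scalemxAl.
by rewrite mxtraceD mxtraceZ.
Qed.

Let sym_inner_gt0 (x : S) : x != 0 -> 0 < sym_inner x x.
Proof.
have E : sym_inner x x = \sum_i \sum_j mx_of_sym x j i ^+ 2.
  apply: eq_bigr => i _; rewrite mxE; apply: eq_bigr => j _.
  by rewrite mxE expr2.
have ge0 i : 0 <= \sum_j mx_of_sym x j i ^+ 2.
  by apply: sumr_ge0 => j _; exact: sqr_ge0.
move=> x0; rewrite E lt_neqAle eq_sym sumr_ge0 ?andbT//.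
apply: contra x0 => /eqP x0; rewrite -(inj_eq mx_of_sym_inj) linear0.
apply/eqP/matrixP => j i; rewrite mxE; apply/eqP; rewrite -sqrf_eq0; apply/eqP.
have xi : \sum_k mx_of_sym x k i ^+ 2 = 0.
  exact: (psumr_eq0P (fun i _ => ge0 i) x0).
exact: (psumr_eq0P (fun k _ => sqr_ge0 (mx_of_sym x k i)) xi).
Qed.

HB.instance Definition _ :=
  hasInner.Build R S sym_innerC sym_inner_linear sym_inner_gt0.
HB.instance Definition _ := @Lmodule_isNormed.Build R S
  inner_norm inner_normD inner_normZ inner_norm_eq0.
HB.instance Definition _ := isHilbert.Build R S inner_norm_sqr.

End Symmx.

Lemma mem_symspace (R : realType) (p : nat) (A : 'M[R]_p) :
  (A \in symspace R p) = (A^T == A).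
Proof.
have lin : linear (fun B : 'M[R]_p => B - B^T).
  move=> a B C; rewrite linearP/= scalerBr opprD addrACA.
  by [].
pose L := GRing.isLinear.Build R 'M[R]_p 'M[R]_p *:%R
  (fun B : 'M[R]_p => B - B^T) lin.
pose F : {linear 'M[R]_p -> 'M[R]_p} := HB.pack (fun B : 'M[R]_p => B - B^T) L.
by rewrite memv_ker (lfunE F) subr_eq0 eq_sym.
Qed.

Section ProdInner.
Variables (R : realType) (U V : innerVectType R).

Definition prod_inner (z z' : U * V) : R := '<<z.1, z'.1>> + '<<z.2, z'.2>>.

Let prod_innerC x y : prod_inner x y = prod_inner y x.
Proof. by rewrite /prod_inner (innerC x.1) (innerC x.2). Qed.

Let prod_inner_linear (a : R) (x y z : U * V) :
  prod_inner (a *: x + y) z = a * prod_inner x z + prod_inner y z.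
Proof. by rewrite /prod_inner !inner_linearl mulrDr addrACA. Qed.

Let prod_inner_gt0 (x : U * V) : x != 0 -> 0 < prod_inner x x.
Proof.
case: x => x y; rewrite /prod_inner/=; have [->|x0 _] := eqVneq x 0.
  rewrite inner0l add0r => H; apply: inner_pos.
  by apply: contraNneq H => ->.
by rewrite ltr_wpDr ?inner_pos ?inner_ge0.
Qed.

HB.instance Definition _ :=
  hasInner.Build R (U * V)%type prod_innerC prod_inner_linear prod_inner_gt0.

End ProdInner.

Lemma riesz (R : realType) (V : innerVectType R) (l : {linear V -> R^o}) :
  exists v, forall d, l d = '<<v, d>>.
Proof.
have lin (v : V) : linear ((fun d => '<<v, d>>) : V -> R^o).
  by move=> a x y; rewrite innerDr innerZr.
pose phi0 v : {linear V -> R^o} := HB.pack ((fun d => '<<v, d>>) : V -> R^o)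
  (GRing.isLinear.Build R V R^o *:%R ((fun d => '<<v, d>>) : V -> R^o) (lin v)).
pose phi1 v : 'Hom(V, R^o) := linfun (phi0 v).
have phiE v d : phi1 v d = '<<v, d>> by rewrite lfunE.
have lphi : linear phi1.
  move=> a x y; apply/lfunP => d.
  by rewrite add_lfunE scale_lfunE !phiE innerDl innerZl.
pose phi2 : {linear V -> 'Hom(V, R^o)} := HB.pack phi1
  (GRing.isLinear.Build R V 'Hom(V, R^o) *:%R phi1 lphi).
pose phi := linfun phi2.
have phi_inj : lker phi == 0%VS.
  apply/lker0P => x y /lfunP /(_ (x - y)) /eqP.
  rewrite !(lfunE phi2) /= !phiE -subr_eq0 -[- '<<y, _>>]mulN1r -innerZl -innerDl scaleN1r.
  move=> H; apply/eqP; rewrite -subr_eq0; apply: contraTT H => /inner_pos H.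
  by rewrite gt_eqF.
have surj : limg phi = fullv.
  apply/eqP; rewrite eqEdim subvf /= limg_dim_eq; last by rewrite (eqP phi_inj) capv0.
  by rewrite !dimvf /dim /= muln1.
have : linfun l \in limg phi by rewrite surj memvf.
move=> /memv_imgP[v _ E]; exists v => d.
by rewrite -(lfunE l) E (lfunE phi2) /= phiE.
Qed.

Section Operators.
Context {R : realType}.

Definition adjoint (U V : innerVectType R) (L : 'Hom(U, V)) : 'Hom(V, U) :=
  xget 0 [set M : 'Hom(V, U) | forall x y, '<<L x, y>> = '<<x, M y>>].

(* The Loewner order is an order on self-adjoint operators. *)
Definition negdef (V : innerVectType R) (L : 'End(V)) : Prop :=
  (forall x y, '<<L x, y>> = '<<x, L y>>) /\
  (forall x, x != 0 -> '<<x, L x>> < 0).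

(* Operator-norm convergence, without forming the operator norm. *)
Definition op_cvg (T : Type) (F : set_system T) (U V : normedModType R)
    (L : T -> U -> V) (L0 : U -> V) : Prop :=
  forall e : R, 0 < e -> \forall t \near F, forall x : U,
    `|L t x - L0 x| <= e * `|x|.

Definition is_C1 (U V : normedModType R) (F : U -> V) : Prop :=
  (forall x, differentiable F x) /\
  (forall x, op_cvg (nbhs x) (fun y => 'd F y : U -> V) ('d F x)).

(* For finite-dimensional U, F is C^2 iff all the maps x |-> DF(x) d are C^1. *)
Definition is_C2 (U V : normedModType R) (F : U -> V) : Prop :=
  is_C1 F /\ (forall d, is_C1 (fun x => 'd F x d)).

Definition jac (U V : hilbertVectType R) (F : U -> V) (x : U) : 'Hom(U, V) :=
  linfun ('d F x).

Definition nabla (U V : hilbertVectType R) (F : U -> V) (x : U) : 'Hom(V, U) :=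
  adjoint (jac F x).

Definition grad (U : hilbertVectType R) (f : U -> R) (x : U) : U :=
  xget 0 [set v | forall d, 'd f x d = '<<v, d>>].

Definition hessian (U : hilbertVectType R) (f : U -> R) (x : U) : 'End(U) :=
  jac (grad f) x.

Definition B_subdiff (U V : hilbertVectType R) (F : U -> V) (u : U) :
    set 'Hom(U, V) :=
  [set W | exists u_ : nat -> U,
     [/\ forall k, differentiable F (u_ k),
         u_ @ \oo --> u
       & op_cvg \oo (fun k => jac F (u_ k) : U -> V) W]].

Definition metric_proj (U : hilbertVectType R) (C : set U) (u : U) : U :=
  xget 0 [set z | C z /\ forall z', C z' -> `|u - z| <= `|u - z'|].

Definition tangent_cone (U : hilbertVectType R) (C : set U) (z : U) : set U :=
  [set d | exists (t : nat -> R) (d_ : nat -> U),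
     [/\ forall k, 0 < t k,
         t @ \oo --> (0 : R),
         d_ @ \oo --> d
       & forall k, C (z + t k *: d_ k)]].

(* For a convex cone this union of subspaces is the largest one. *)
Definition lineality (U : hilbertVectType R) (K : set U) : set U :=
  \bigcup_(L in [set L : {vspace U} | [set x | x \in L] `<=` K])
    [set x | x \in L].

End Operators.

Lemma adjointP (R : realType) (U V : innerVectType R) (L : 'Hom(U, V)) x y :
  '<<L x, y>> = '<<x, adjoint L y>>.
Proof.
suff [M HM] : exists M : 'Hom(V, U), forall x y, '<<L x, y>> = '<<x, M y>>.
  by rewrite /adjoint; case: xgetP => [M' _ /(_ x y)|/(_ M)/(_ HM)].
have H z : exists v, forall d, '<<L d, z>> = '<<v, d>>.
  have lin : linear ((fun d => '<<L d, z>>) : U -> R^o).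
    by move=> a u v; rewrite linearP innerDl innerZl.
  exact: (riesz (HB.pack ((fun d => '<<L d, z>>) : U -> R^o)
    (GRing.isLinear.Build R U R^o *:%R ((fun d => '<<L d, z>>) : U -> R^o) lin))).
have [M0 HM0] := choice H.
have ext (u v : U) : (forall d, '<<u, d>> = '<<v, d>>) -> u = v.
  move=> uv; apply/eqP; rewrite -subr_eq0; apply: contraT => /inner_pos.
  by rewrite innerDl -[- v]scaleN1r innerZl uv mulN1r subrr ltxx.
have lin : linear M0.
  move=> a u v; apply: ext => d.
  by rewrite -HM0 innerDl innerZl innerDr innerZr !HM0.
pose M : {linear V -> U} := HB.pack M0 (GRing.isLinear.Build R V U *:%R M0 lin).
by exists (linfun M) => u v; rewrite (lfunE M) /= HM0 innerC.
Qed.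

Lemma gradP (R : realType) (U : hilbertVectType R) (f : U -> R) x d :
  'd f x d = '<<grad f x, d>>.
Proof.
have lin : linear (('d f x : U -> R) : U -> R^o) by move=> a u v; rewrite linearP.
have [v Hv] := riesz (HB.pack (('d f x : U -> R) : U -> R^o)
   (GRing.isLinear.Build R U R^o *:%R (('d f x : U -> R) : U -> R^o) lin) : {linear U -> R^o}).
by rewrite /grad; case: xgetP => [w _ /(_ d)|/(_ v)/(_ Hv)].
Qed.

Section Matrices.
Context {R : realType} {p : nat}.

Definition psd : set (symmx R p) :=
  [set Z | forall v : 'cV[R]_p, 0 <= (v^T *m mx_of_sym Z *m v) 0 0].

Definition spectral_decomp (Z : symmx R p) (P : 'M[R]_p) (rho : 'rV[R]_p) :=
  [/\ P^T *m P = 1%:M,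
      forall i j : 'I_p, (i <= j)%N -> rho 0 j <= rho 0 i
    & mx_of_sym Z = P *m diag_mx rho *m P^T].

Definition zero_idx (rho : 'rV[R]_p) : {set 'I_p} := [set i | rho 0 i == 0]%SET.
Definition neg_idx (rho : 'rV[R]_p) : {set 'I_p} := [set i | rho 0 i < 0]%SET.

Definition cols (P : 'M[R]_p) (I : {set 'I_p}) : 'M[R]_(p, #|I|) :=
  colsub (fun k : 'I_#|I| => enum_val k) P.

(* The Moore-Penrose inverse (distinct from pinvmx). *)
Definition mp_inv (B : 'M[R]_p) : 'M[R]_p :=
  xget 0 [set Y : 'M[R]_p | [/\ B *m Y *m B = B, Y *m B *m Y = Y,
                      (B *m Y)^T = B *m Y & (Y *m B)^T = Y *m B]].

Definition Upsilon (B G A : symmx R p) : R :=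
  2 * \tr ((mx_of_sym G)^T *m
           (mx_of_sym A *m mp_inv (mx_of_sym B) *m mx_of_sym A)).

End Matrices.

Section NLSDP.
Context {R : realType} {X : hilbertVectType R} {m p : nat}.
Variables (f : X -> R) (h : X -> evec R m) (g : X -> symmx R p).

Definition lagrangian (lm : evec R m * symmx R p) (x : X) : R :=
  f x - '<<lm.1, h x>> - '<<lm.2, g x>>.

Definition multipliers (x : X) : set (evec R m * symmx R p) :=
  [set lm | [/\ grad (lagrangian lm) x = 0, h x = 0,
                psd (g x), psd lm.2 & '<<lm.2, g x>> = 0]].

Definition stationary (x : X) : Prop := multipliers x !=set0.

(* The condition does not depend on the choice of spectral decomposition. *)
Definition app (x : X) (lm : evec R m * symmx R p) : set X :=
  [set d | jac h x d = 0 /\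
     exists (P : 'M[R]_p) (rho : 'rV[R]_p),
     let Pb := cols P (zero_idx rho) in
     let Pc := cols P (neg_idx rho) in
     [/\ spectral_decomp (g x - lm.2) P rho,
         Pb^T *m mx_of_sym (jac g x d) *m Pc = 0
       & Pc^T *m mx_of_sym (jac g x d) *m Pc = 0]].

Definition Chat (x : X) : set X :=
  \bigcap_(lm in multipliers x) app x lm.

Definition constraint_nondegenerate (x : X) : Prop :=
  [set (jac h x d, jac g x d + B) | d in [set: X]
      & B in lineality (tangent_cone psd (g x))]
  = [set: evec R m * symmx R p].

Definition strong_SOSC (x : X) : Prop :=
  forall d, Chat x d -> d != 0 ->
  (0 < ereal_sup [set ('<<d, hessian (lagrangian lm) x d>>
                       - Upsilon (g x) lm.2 (jac g x d))%:E
                 | lm in multipliers x])%E.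

Definition Aop (c : R) (x : X) (lm : evec R m * symmx R p)
    (W : 'End(symmx R p)) : 'End(X) :=
  hessian (lagrangian lm) x
  + c *: (nabla h x \o jac h x)%VF
  + c *: (nabla g x \o W \o jac g x)%VF.

(* The lfun inverse is the true inverse when Aop is bijective. *)
Definition Vop (c : R) (x : X) (lm : evec R m * symmx R p)
    (W : 'End(symmx R p)) : 'End((evec R m * symmx R p)%type) :=
  linfun (fun z : evec R m * symmx R p =>
    let y := ((Aop c x lm W)^-1)%VF (nabla h x z.1 + nabla g x (W z.2)) in
    - (jac h x y, W (jac g x y)) - (0, c^-1 *: (z.2 - W z.2))).

Definition dBproj (c : R) (x : X) (lm : evec R m * symmx R p) :
    set 'End(symmx R p) :=
  B_subdiff (metric_proj psd) (lm.2 - c *: g x).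

Definition Vset (c : R) (x : X) (lm : evec R m * symmx R p) :
    set 'End((evec R m * symmx R p)%type) :=
  [set Vop c x lm W | W in dBproj c x lm].

End NLSDP.

Lemma lfun_comb (R : realType) (U V : vectType R) (L : 'Hom(U, V)) a u v :
  L (a *: u + v) = a *: L u + L v.
Proof. exact: linearP. Qed.

Lemma VopE (R : realType) (X : hilbertVectType R) (m p : nat)
    (f : X -> R) (h : X -> evec R m) (g : X -> symmx R p) c x lm W z :
  Vop f h g c x lm W z =
    let y := ((Aop f h g c x lm W)^-1)%VF (nabla h x z.1 + nabla g x (W z.2)) in
    - (jac h x y, W (jac g x y)) - (0, c^-1 *: (z.2 - W z.2)).
Proof.
pose F (z : evec R m * symmx R p) :=
  let y := ((Aop f h g c x lm W)^-1)%VF (nabla h x z.1 + nabla g x (W z.2)) in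
    - (jac h x y, W (jac g x y)) - (0, c^-1 *: (z.2 - W z.2)).
have lin : linear F.
  pose Y (z : evec R m * symmx R p) :=
    ((Aop f h g c x lm W)^-1)%VF (nabla h x z.1 + nabla g x (W z.2)).
  have Ylin a u v : Y (a *: u + v) = a *: Y u + Y v.
    rewrite /Y -lfun_comb; congr (_ _).
    by rewrite /= !lfun_comb scalerDr addrACA.
  have FE w : F w = (- jac h x (Y w),
      - W (jac g x (Y w)) - c^-1 *: (w.2 - W w.2)).
    by rewrite /F -/(Y w); congr pair => /=; rewrite ?subr0.
  move=> a u v; rewrite !FE Ylin !lfun_comb.
  congr pair => /=; first by rewrite opprD scalerN.
  have -> : a *: u.2 + v.2 - (a *: W u.2 + W v.2)
      = a *: (u.2 - W u.2) + (v.2 - W v.2) by rewrite opprD addrACA scalerBr.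
  rewrite (scalerBr a (- _)) scalerN [c^-1 *: (_ + _)]scalerDr !opprD addrACA.
  by rewrite !scalerA (mulrC a).
exact: (@lfunE _ _ _ (HB.pack F (GRing.isLinear.Build R
  (evec R m * symmx R p)%type (evec R m * symmx R p)%type *:%R F lin))).
Qed.

(* Main.v *)
(* Write [G = g xs], [M = ms]; complementarity gives [M G = 0], so [G] and [M]
   are the positive and negative parts of [G - M], and [M] is the projection of
   [M - c G] for every [c >= 0].

   (i) and the definiteness in (iii): a symmetric [Z] with [Z G = 0] is
   orthogonal to [lin (T (G))], so nondegeneracy makes
   [z |-> nabla h z.1 + nabla g z.2] injective on the pairs with [z.2 G = 0].

   (ii): with [Z = proj U] and [N = Z - U], differentiating [Z N = 0] in the
   direction [B] gives [Y N + Z Y = Z B] for [Y = J B]. This equation, the firm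
   nonexpansiveness [<Y, Y> <= <Y, B>] and the symmetry of [J] (it is the second
   derivative of [|proj U|^2 / 2]) pass to the B-subdifferential. At
   [U = M - c G] the equation reads [c Y G + M Y = M B], so in an eigenbasis of
   [G - M] the gamma-beta and gamma-gamma entries of [Y] and [B] agree;
   hence [<B, W B>] dominates the squared norm of exactly those entries, which
   [app] requires to vanish. As [Upsilon G M >= 0], the second-order condition makes
   the Hessian of the Lagrangian positive on [app] and Finsler's lemma applies.

   (iii): with [y = A^-1 (nabla h z.1 + nabla g (W z.2))],
   [<z, V z> = - <y, A y> - c^-1 <z.2, z.2 - W z.2>], and equality with [0]
   forces [W z.2 = z.2], hence [z.2 G = 0]. *)

Require Import Defs.
From mathcomp Require Import all_boot all_order all_algebra.
From mathcomp Require Import boolp classical_sets functions reals ereal.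
From mathcomp Require Import topology normedtype sequences landau derive.
From HB Require Import structures.
From mathcomp Require Import ring lra.

Import Order.TTheory GRing.Theory Num.Theory.
Import numFieldNormedType.Exports.

Set Implicit Arguments.
Unset Strict Implicit.
Unset Printing Implicit Defensive.

Local Open Scope ring_scope.
Local Open Scope classical_set_scope.

(** * Quadratic forms and the real spectral theorem *)

Definition mxform (R : comNzRingType) n (A : 'M[R]_n) (v w : 'cV[R]_n) : R :=
  (v^T *m A *m w) 0 0.

Section MxForm.
Context {R : comNzRingType} {n : nat}.
Implicit Types (A B : 'M[R]_n) (v w u : 'cV[R]_n).

Lemma mxformE A v w :
  mxform A v w = \sum_j (\sum_i v i 0 * A i j) * w j 0.
Proof.
rewrite /mxform mxE; apply: eq_bigr => j _; congr (_ * _).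
by rewrite mxE; apply: eq_bigr => i _; rewrite mxE.
Qed.

Lemma mxformDl A u v w : mxform A (u + v) w = mxform A u w + mxform A v w.
Proof. by rewrite /mxform linearD/= !mulmxDl mxE. Qed.

Lemma mxformDr A u v w : mxform A w (u + v) = mxform A w u + mxform A w v.
Proof. by rewrite /mxform mulmxDr mxE. Qed.

Lemma mxformZl A a v w : mxform A (a *: v) w = a * mxform A v w.
Proof. by rewrite /mxform linearZ/= -!scalemxAl mxE. Qed.

Lemma mxformZr A a v w : mxform A v (a *: w) = a * mxform A v w.
Proof. by rewrite /mxform -scalemxAr mxE. Qed.

Lemma mxformD A B v w : mxform (A + B) v w = mxform A v w + mxform B v w.
Proof. by rewrite /mxform mulmxDr mulmxDl mxE. Qed.

Lemma mxformZ a A v w : mxform (a *: A) v w = a * mxform A v w.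
Proof. by rewrite /mxform -scalemxAr -scalemxAl mxE. Qed.

Lemma mxformC A v w : A^T = A -> mxform A v w = mxform A w v.
Proof.
move=> As; rewrite /mxform.
have -> : w^T *m A *m v = (v^T *m A *m w)^T by rewrite !trmx_mul trmxK As mulmxA.
by rewrite [RHS]mxE.
Qed.

Lemma mxform_conj m (P : 'M[R]_(n, m)) A (v w : 'cV[R]_m) :
  mxform A (P *m v) (P *m w) = mxform (P^T *m A *m P) v w.
Proof. by rewrite /mxform trmx_mul !mulmxA. Qed.

Lemma mxform_delta A i j : mxform A (delta_mx i 0) (delta_mx j 0) = A i j.
Proof. by rewrite /mxform trmx_delta -rowE -colE !mxE. Qed.

Lemma mxform_diag (d : 'rV[R]_n) v :
  mxform (diag_mx d) v v = \sum_i d 0 i * v i 0 ^+ 2.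
Proof.
rewrite /mxform mul_mx_diag mxE; apply: eq_bigr => i _.
by rewrite !mxE mulrAC mulrC expr2.
Qed.

End MxForm.

Section MxFormReal.
Context {R : realType} {n : nat}.
Implicit Types (A B : 'M[R]_n) (v w u : 'cV[R]_n).

Lemma mxform1 v : mxform 1%:M v v = \sum_i v i 0 ^+ 2.
Proof.
by rewrite /mxform mulmx1 mxE; apply: eq_bigr => i _; rewrite mxE expr2.
Qed.

Lemma mxform1_gt0 v : v != 0 -> 0 < mxform 1%:M v v.
Proof.
move=> v0; rewrite mxform1 lt_neqAle eq_sym sumr_ge0 ?andbT; last first.
  by move=> i _; exact: sqr_ge0.
apply: contra v0 => /eqP v0; apply/eqP/colP => i; rewrite mxE.
by apply/eqP; rewrite -sqrf_eq0; apply/eqP/(psumr_eq0P _ v0) => // j _; apply: sqr_ge0.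
Qed.

(** Along the line [v + t *: A v] the form equals a quadratic in [t] without constant term, whose
    linear coefficient is twice the squared length of [A v]. It can only stay nonnegative if that
    coefficient vanishes. *)
Lemma mxform_ge0_ker A v : A^T = A -> (forall w, 0 <= mxform A w w) ->
  mxform A v v = 0 -> A *m v = 0.
Proof.
move=> As Age0 Av0; set w := A *m v.
have wE : mxform A w v = mxform 1%:M w w by rewrite /mxform mulmx1 -mulmxA.
apply/eqP; apply: contraT => /mxform1_gt0 w0.
have Hx t : 0 <= 2 * t * mxform 1%:M w w + t ^+ 2 * mxform A w w.
  have := Age0 (v + t *: w).
  rewrite mxformDl !mxformDr !mxformZl !mxformZr Av0 add0r (mxformC v w As) wE.
  set a := mxform A w w; set b := mxform 1%:M w w.
  rewrite mulrA.
  suff -> : t * b + (t * b + t * t * a) = 2 * t * b + t ^+ 2 * a by [].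
  ring.
move: Hx w0 (Age0 w); set a := mxform 1%:M w w; set b := mxform A w w => Hx a0 b0.
(* Near-minimiser of [2 * t * a + t ^+ 2 * b]; the added 1 keeps the denominator positive when
   [b = 0]. *)
have := Hx (- a / (b + 1)).
have b1 : 0 < b + 1 by lra.
have -> : 2 * (- a / (b + 1)) * a + (- a / (b + 1)) ^+ 2 * b
  = - (a / (b + 1)) ^+ 2 * (b + 2) by field; rewrite gt_eqF.
have : 0 < (a / (b + 1)) ^+ 2 by rewrite exprn_gt0// divr_gt0.
nra.
Qed.

Lemma cvg_sumr (T I : Type) (F : set_system T) (r : seq I) (P : pred I)
    (f : I -> T -> R) (a : I -> R) : Filter F ->
  (forall i, f i t @[t --> F] --> a i) ->
  \sum_(i <- r | P i) f i t @[t --> F] --> \sum_(i <- r | P i) a i.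
Proof.
move=> FF fa; apply: cvg_big => //.
exact: (@pseudometric_normed_Zmodule.add_continuous R R).
Qed.

Lemma cvg_mxform (T : Type) (F : set_system T) A (v : T -> 'cV[R]_n) (a : 'cV[R]_n) :
  Filter F -> (forall i, v t i 0 @[t --> F] --> a i 0) ->
  mxform A (v t) (v t) @[t --> F] --> mxform A a a.
Proof.
move=> FF va; rewrite mxformE.
under eq_cvg do rewrite mxformE.
apply: cvg_sumr => j; apply: cvgM => //; apply: cvg_sumr => i.
by apply: cvgM => //; exact: cvg_cst.
Qed.

Lemma mxform_continuous A :
  continuous (fun u : 'rV[R]_n => mxform A u^T u^T).
Proof.
move=> u; apply: (@cvg_mxform _ (nbhs u) A trmx) => i; rewrite mxE.
under eq_cvg do rewrite mxE.
exact: coord_continuous.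
Qed.

(** Euclidean sphere inside row vectors, the form in which the compactness criterion and the extreme
    value theorem apply. *)
Definition usphere : set 'rV[R]_n := [set u : 'rV_n | mxform 1%:M u^T u^T = 1].

Lemma compact_usphere : compact usphere.
Proof.
apply: bounded_closed_compact; last first.
  rewrite (_ : usphere = (fun u : 'rV_n => mxform 1%:M u^T u^T) @^-1` [set 1]) //.
  apply: closed_comp => [u _|]; first exact: mxform_continuous.
  exact: closed_eq.
exists 1; split; first exact: num_real.
move=> M M1 u /=; rewrite /usphere/= mxform1 => u1.
rewrite [leLHS]/Num.norm /= mx_normrE; apply: bigmax_le => [|[i j] _ /=].
  exact: ltW (lt_trans ltr01 M1).
apply: le_trans (ltW M1); rewrite (ord1 i) -(@ler_pXn2r _ 2)// ?nnegrE//.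
rewrite real_normK ?num_real// expr1n -u1 (bigD1 j)//= mxE lerDl.
by apply: sumr_ge0 => k _; exact: sqr_ge0.
Qed.

End MxFormReal.
(** Take [v] maximising the form on the unit sphere and [r] the maximum. Then [r%:M - A] is positive
    semidefinite and its form vanishes at [v], so [v] lies in its kernel. *)
Lemma rayleigh_max (R : realType) n (A : 'M[R]_n.+1) : A^T = A ->
  exists (v : 'cV[R]_n.+1) (r : R), [/\ mxform 1%:M v v = 1, A *m v = r *: v
    & forall w, mxform A w w <= r * mxform 1%:M w w].
Proof.
move=> As.
have S0 : @usphere R n.+1 !=set0.
  by exists (delta_mx 0 0); rewrite /usphere/= trmx_delta mxform_delta mxE eqxx.
have Ac : {within @usphere R n.+1, continuous (fun u : 'rV_n.+1 => mxform A u^T u^T)}.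
  apply: continuous_subspaceT. exact: mxform_continuous.
have [c /[!inE] c1 cmax] := EVT_max_rV S0 (@compact_usphere R n.+1) Ac.
set v := c^T; set r := mxform A v v.
have maxr w : mxform A w w <= r * mxform 1%:M w w.
  have [->|w0] := eqVneq w 0; first by rewrite /mxform !mulmx0 !mxE mulr0.
  have s0 := mxform1_gt0 w0; set s := mxform 1%:M w w in s0 *.
  have t2 : (Num.sqrt s)^-1 * (Num.sqrt s)^-1 = s^-1.
    by rewrite -invfM -expr2 sqr_sqrtr// ltW.
  have /cmax : (Num.sqrt s)^-1 *: w^T \in usphere.
    rewrite inE /usphere/= linearZ/= trmxK mxformZl mxformZr mulrA t2.
    by rewrite mulVf// gt_eqF.
  rewrite linearZ/= trmxK mxformZl mxformZr mulrA t2.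
  by rewrite ler_pdivrMl// mulrC.
exists v, r; split=> //.
pose B := r%:M - A.
have BE w : mxform B w w = r * mxform 1%:M w w - mxform A w w.
  by rewrite /B -scaleN1r mxformD -(scalemx1 _ r) !mxformZ mulN1r.
have : B *m v = 0.
  apply: mxform_ge0_ker; first by rewrite /B linearB/= tr_scalar_mx As.
    by move=> w; rewrite BE subr_ge0.
  by rewrite BE [mxform 1%:M v v]c1 mulr1 subrr.
by move=> /eqP; rewrite mulmxBl mul_scalar_mx subr_eq0 => /eqP.
Qed.

(** The reflection in the hyperplane orthogonal to [v - w] exchanges two vectors of equal length. *)
Lemma householder (R : realType) n (v w : 'cV[R]_n) :
  mxform 1%:M v v = 1 -> mxform 1%:M w w = 1 ->
  exists Q : 'M[R]_n, [/\ Q^T = Q, Q *m Q = 1%:M & Q *m w = v].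
Proof.
move=> v1 w1; have [->|vw] := eqVneq v w.
  by exists 1%:M; rewrite tr_scalar_mx !mul1mx.
set u := v - w; have u0 : u != 0 by rewrite subr_eq0.
have s0 := mxform1_gt0 u0; set s := mxform 1%:M u u in s0.
have uu : u^T *m u = s%:M by rewrite [LHS]mx11_scalar /s /mxform mulmx1.
have sE : s = 2 - 2 * mxform 1%:M v w.
  rewrite /s /u -scaleN1r !mxformDl !mxformDr !mxformZl !mxformZr v1 w1.
  rewrite (mxformC w v (tr_scalar_mx _ _)); ring.
have uw : u^T *m w = (- s / 2)%:M.
  rewrite [LHS]mx11_scalar; suff -> : (u^T *m w) 0 0 = - s / 2 by [].
  have -> : (u^T *m w) 0 0 = mxform 1%:M u w by rewrite /mxform mulmx1.
  rewrite /u mxformDl -scaleN1r mxformZl w1 sE; by field.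
exists (1%:M - (2 / s) *: (u *m u^T)); split.
- by rewrite linearB/= linearZ/= trmx_mul trmxK tr_scalar_mx.
- have TT : u *m u^T *m (u *m u^T) = s *: (u *m u^T).
    by rewrite mulmxA -[u *m u^T *m u]mulmxA uu mul_mx_scalar -scalemxAl.
  rewrite mulmxBl mul1mx mulmxBr mulmx1 -scalemxAl -scalemxAr TT !scalerA.
  rewrite (_ : 2 / s * (2 / s) * s = 2 / s + 2 / s); last by field; rewrite gt_eqF.
  by rewrite scalerDl opprB addrK subrK.
- rewrite mulmxBl mul1mx -scalemxAl -mulmxA uw mul_mx_scalar scalerA.
  rewrite (_ : 2 / s * (- s / 2) = -1) ?scaleN1r ?opprK; last by field; rewrite gt_eqF.
  by rewrite /u addrC subrK.
Qed.

(** Deflation: a reflection moves a top eigenvector to the first basis vector, symmetry splits off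
    the first row and column, and induction handles the remaining block. *)
Lemma real_spectral (R : realType) n (A : 'M[R]_n) : A^T = A ->
  exists (P : 'M[R]_n) (rho : 'rV[R]_n),
  [/\ P^T *m P = 1%:M, forall i j : 'I_n, (i <= j)%N -> rho 0 j <= rho 0 i
    & A = P *m diag_mx rho *m P^T].
Proof.
elim: n A => [|n IH] A As.
  exists 1%:M, 0; split; first by rewrite tr_scalar_mx mul1mx.
  - by case.
  - by rewrite [A]flatmx0 [RHS]flatmx0.
have [v [r [v1 Av rmax]]] := rayleigh_max As.
pose e : 'cV[R]_(1 + n) := delta_mx 0 0.
have e1 : mxform 1%:M e e = 1 by rewrite mxform_delta mxE eqxx.
have [Q [Qs QQ Qe]] := householder v1 e1.
have [A' A'd] : exists A' : 'M[R]_(1 + n), A' = Q *m A *m Q by exists (Q *m A *m Q).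
have A's : A'^T = A' by rewrite A'd !trmx_mul Qs As mulmxA.
have Qv : Q *m v = e by rewrite -Qe mulmxA QQ mul1mx.
have A'e : A' *m e = r *: e by rewrite A'd -!mulmxA Qe Av -scalemxAr Qv.
have A'c i : A' i 0 = r * (i == 0)%:R.
  by have /colP/(_ i) := A'e; rewrite -colE !mxE eqxx andbT.
have l0 : lshift n (0 : 'I_1) = 0 :> 'I_(1 + n) by apply/val_inj.
have A'E : A' = block_mx r%:M 0 0 (drsubmx A').
  rewrite -[A' in LHS]submxK; congr block_mx.
  - by rewrite [LHS]mx11_scalar !mxE l0 A'c eqxx mulr1.
  - by apply/rowP => j; rewrite !mxE -A's mxE l0 A'c mulr0.
  - by apply/colP => j; rewrite !mxE l0 A'c mulr0.
have [|P' [rho' [P'P' sorted' DE]]] := IH (drsubmx A').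
  by rewrite -[LHS]/(drsubmx A')^T trmx_drsub A's.
pose K : 'M[R]_(1 + n) := block_mx 1%:M 0 0 P'.
exists (Q *m K), (row_mx r%:M rho').
have KT : K^T = block_mx 1%:M 0 0 P'^T by rewrite /K tr_block_mx tr_scalar_mx !trmx0.
have KK : K^T *m K = 1%:M.
  rewrite KT /K mulmx_block !mul0mx !mulmx0 !mul1mx !addr0 !add0r P'P'.
  by rewrite -scalar_mx_block.
have KA'K : K^T *m A' *m K = block_mx r%:M 0 0 (diag_mx rho').
  rewrite A'E KT /K !mulmx_block !mul0mx !mulmx0 !mul1mx !addr0 !add0r.
  by rewrite DE !mulmxA P'P' mul1mx -mulmxA P'P' !mulmx1 mul0mx.
split.
- by rewrite trmx_mul Qs mulmxA -[K^T *m Q *m Q]mulmxA QQ mulmx1.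
(* The new eigenvalue goes first: the Rayleigh bound at the eigenvector belonging to [rho' 0 j]
   gives [rho' 0 j <= r]. *)
- have r'r j : rho' 0 j <= r.
    set p := col_mx (0 : 'cV[R]_1) (col j P').
    have pp B : mxform B (Q *m p) (Q *m p) = mxform (K^T *m (Q *m B *m Q) *m K)
        (delta_mx (rshift 1 j) 0) (delta_mx (rshift 1 j) 0).
      rewrite -mxform_conj.
      suff -> : K *m delta_mx (rshift 1 j) 0 = p by rewrite mxform_conj Qs.
      by rewrite -colE /K block_mxEh colKr col_col_mx col0.
    have := rmax (Q *m p).
    rewrite !pp -A'd mulmx1 QQ mulmx1 KK !mxform_delta [X in r * X]mxE eqxx mulr1.
    rewrite KA'K.
    by rewrite block_mxEdr mxE eqxx mulr1n.
  move=> i j; rewrite !mxE.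
  case: splitP => j' jE; case: splitP => i' iE.
  + by rewrite !ord1.
  + by rewrite jE iE ord1.
  + by rewrite !ord1 mxE eqxx r'r.
  + by rewrite jE iE leq_add2l; exact: sorted'.
- have -> : A = Q *m A' *m Q by rewrite A'd !mulmxA QQ mul1mx -mulmxA QQ mulmx1.
  have KKT : K *m K^T = 1%:M by exact: mulmx1C.
  have -> : diag_mx (row_mx r%:M rho') = K^T *m A' *m K.
    by rewrite KA'K diag_mx_row; congr block_mx; apply/matrixP => a b; rewrite !ord1 !mxE.
  rewrite trmx_mul Qs !mulmxA -[Q *m K *m K^T]mulmxA KKT mulmx1.
  by rewrite -[_ *m K *m K^T]mulmxA KKT mulmx1.
Qed.

(** * Inner products and positive semidefinite matrices *)

Section InnerMore.
Context {R : realType} {V : innerVectType R}.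
Implicit Types x y z : V.

Lemma inner0r x : '<<x, 0>> = 0.
Proof. by rewrite innerC inner0l. Qed.

Lemma innerNl x y : '<<- x, y>> = - '<<x, y>>.
Proof. by rewrite -scaleN1r innerZl mulN1r. Qed.

Lemma innerNr x y : '<<x, - y>> = - '<<x, y>>.
Proof. by rewrite innerC innerNl innerC. Qed.

Lemma innerBl x y z : '<<x - y, z>> = '<<x, z>> - '<<y, z>>.
Proof. by rewrite innerDl innerNl. Qed.

Lemma innerBr x y z : '<<z, x - y>> = '<<z, x>> - '<<z, y>>.
Proof. by rewrite innerDr innerNr. Qed.

Lemma inner_sqrB x y : '<<x - y, x - y>> = '<<x, x>> - 2 * '<<x, y>> + '<<y, y>>.
Proof. by rewrite innerBl !innerBr (innerC y x); ring. Qed.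

Lemma inner_sqrB_le x y : '<<y, y>> <= '<<y, x>> ->
  '<<x - y, x - y>> <= '<<x, x>> - '<<y, x>>.
Proof. by rewrite inner_sqrB (innerC x y); lra. Qed.

Lemma inner_eq0 x : '<<x, x>> = 0 -> x = 0.
Proof. by move=> x0; apply/eqP; apply: contraTT isT => /inner_pos; rewrite x0 ltxx. Qed.

End InnerMore.

Lemma norm_CS (R : realType) (V : hilbertVectType R) (x y : V) :
  `| '<<x, y>> | <= `|x| * `|y|.
Proof.
have nE (z : V) : inner_norm z = `|z|.
  by rewrite /inner_norm -normr_inner sqrtr_sqr normr_id.
rewrite ler_norml -!nE inner_CS andbT lerNl -innerNl.
by apply: le_trans (inner_CS _ _) _; rewrite !nE normrN.
Qed.

Section Psd.
Context {R : realType} {p : nat}.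
Implicit Types Z U N A B : symmx R p.

Lemma mx_of_symT Z : (mx_of_sym Z)^T = mx_of_sym Z.
Proof. by apply/eqP; rewrite -mem_symspace; exact: subvsP. Qed.

Lemma mx_of_sym_surj (M : 'M[R]_p) : M^T = M -> exists Z, mx_of_sym Z = M.
Proof.
by move=> /eqP; rewrite -mem_symspace => MS; exists (Subvs MS).
Qed.

Lemma sym_innerE A B : '<<A, B>> = \tr (mx_of_sym A *m mx_of_sym B).
Proof. by rewrite -[LHS]/(sym_inner A B) /sym_inner mx_of_symT. Qed.

Lemma psdE Z : psd Z <-> forall v, 0 <= mxform (mx_of_sym Z) v v.
Proof. by []. Qed.

Lemma spectral_exists Z : exists P rho, spectral_decomp Z P rho.
Proof. by have [P [rho ?]] := real_spectral (mx_of_symT Z); exists P, rho. Qed.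

Lemma mxtrace_spectral (P : 'M[R]_p) (a : 'rV[R]_p) (N : 'M[R]_p) :
  \tr (P *m diag_mx a *m P^T *m N) =
  \sum_i a 0 i * mxform N (P *m delta_mx i 0) (P *m delta_mx i 0).
Proof.
rewrite -!mulmxA mxtrace_mulC -!mulmxA mul_diag_mx; apply: eq_bigr => i _.
by rewrite mxE mxform_conj mxform_delta mulmxA.
Qed.

(** In an eigenbasis of [M] the trace is a combination, with the nonnegative eigenvalues as weights,
    of values of the form of [N]. *)
Lemma psd_trace_ge0 (M N : 'M[R]_p) : M^T = M -> (forall v, 0 <= mxform M v v) ->
  (forall v, 0 <= mxform N v v) -> 0 <= \tr (M *m N).
Proof.
move=> Ms M0 N0; have [P [rho [PP _ ME]]] := real_spectral Ms.
have rho0 i : 0 <= rho 0 i.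
  have := M0 (P *m delta_mx i 0); rewrite mxform_conj ME !mulmxA PP mul1mx.
  by rewrite -mulmxA PP mulmx1 mxform_delta mxE eqxx mulr1n.
rewrite ME mxtrace_spectral; apply: sumr_ge0 => i _; rewrite mulr_ge0//; exact: N0.
Qed.

Lemma psd_inner_ge0 A B : psd A -> psd B -> 0 <= '<<A, B>>.
Proof.
by move=> A0 B0; rewrite sym_innerE; apply: psd_trace_ge0 => //; exact: mx_of_symT.
Qed.

(** Moreau's criterion. It yields the Pythagorean inequality [key], which shows both that [Z] is a
    nearest point and that every nearest point equals [Z]; the latter matters because [metric_proj]
    is a choice. *)
Lemma metric_proj_psd_eq U Z : psd Z -> psd (Z - U) -> '<<Z, Z - U>> = 0 ->
  metric_proj psd U = Z.
Proof.
move=> Z0 N0 ZN.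
have key Z' : psd Z' -> `|U - Z| ^+ 2 + `|Z - Z'| ^+ 2 <= `|U - Z'| ^+ 2.
  move=> Z'0; have NZ' := psd_inner_ge0 N0 Z'0.
  have -> : U - Z' = (Z - Z') - (Z - U) by rewrite opprB [RHS]addrC addrA subrK.
  have -> : `|U - Z| = `|Z - U| by rewrite distrC.
  have nE (x : symmx R p) : `|x| ^+ 2 = '<<x, x>> by exact: normr_inner.
  rewrite !nE; set N := Z - U in ZN N0 NZ' *; set E := Z - Z'.
  have EN : '<<E, N>> <= 0 by rewrite /E innerBl ZN sub0r oppr_le0 innerC.
  rewrite (inner_sqrB E N); lra.
rewrite /metric_proj; case: xgetP => [z zE [z0 zmin]|/(_ Z) []]; last first.
  split=> // Z' Z'0; rewrite -(@ler_pXn2r _ 2)// ?nnegrE//.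
  by apply: le_trans (key _ Z'0); rewrite lerDl sqr_ge0.
apply/eqP; rewrite -subr_eq0 -normr_eq0 distrC -sqrf_eq0 -[_ == _]andbT.
have := zmin _ Z0; rewrite -(@ler_pXn2r _ 2)// ?nnegrE// => /(le_trans (key _ z0)).
by rewrite gerDl andbT eq_le sqr_ge0 andbT.
Qed.

(** Clamping the eigenvalues splits [U] into two semidefinite parts with zero product, so Moreau's
    criterion applies. *)
Lemma metric_proj_spectral U P rho : spectral_decomp U P rho ->
  let Z := metric_proj psd U in
  [/\ mx_of_sym Z = P *m diag_mx (\row_i Num.max (rho 0 i) 0) *m P^T,
      mx_of_sym (Z - U) = P *m diag_mx (\row_i Num.max (- rho 0 i) 0) *m P^T,
      psd Z, psd (Z - U) & '<<Z, Z - U>> = 0].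
Proof.
move=> [PP _ UE].
set a := \row_i Num.max (rho 0 i) 0; set b := \row_i Num.max (- rho 0 i) 0.
have diagT (d : 'rV[R]_p) : (P *m diag_mx d *m P^T)^T = P *m diag_mx d *m P^T.
  by rewrite !trmx_mul trmxK tr_diag_mx mulmxA.
have ab : a - b = rho.
  apply/rowP => i; rewrite !mxE; case: (lerP 0 (rho 0 i)) => r0.
    by rewrite max_r ?oppr_le0// subr0.
  by rewrite max_l ?oppr_ge0 ?ltW// opprK add0r.
have diagge0 (d : 'rV[R]_p) : (forall i, 0 <= d 0 i) ->
    forall v, 0 <= mxform (P *m diag_mx d *m P^T) v v.
  move=> d0 v; rewrite -{1}[P]trmxK -mxform_conj mxform_diag.
  by apply: sumr_ge0 => i _; rewrite mulr_ge0// sqr_ge0.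
have [Z ZE] := mx_of_sym_surj (diagT a).
have NE : mx_of_sym (Z - U) = P *m diag_mx b *m P^T.
  by rewrite linearB/= ZE UE -mulmxBl -mulmxBr -linearB/= -ab opprB addrC subrK.
have Z0 : psd Z.
  by apply/psdE; rewrite ZE; apply: diagge0 => i; rewrite mxE le_max lexx orbT.
have N0 : psd (Z - U).
  by apply/psdE; rewrite NE; apply: diagge0 => i; rewrite mxE le_max lexx orbT.
have ZN : '<<Z, Z - U>> = 0.
  have ab0 : diag_mx a *m diag_mx b = 0.
    rewrite mulmx_diag; apply/matrixP => i j; rewrite !mxE.
    case: (lerP 0 (rho 0 i)) => r0; last by rewrite mul0r mul0rn.
    by rewrite [Num.max (- _) _]max_r ?oppr_le0// mulr0 mul0rn.
  rewrite sym_innerE ZE NE -!mulmxA (mulmxA P^T) PP mul1mx (mulmxA (diag_mx a)).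
  by rewrite ab0 mul0mx mulmx0 mxtrace0.
by rewrite (metric_proj_psd_eq Z0 N0 ZN).
Qed.
End Psd.

(** * Differential calculus *)

Section Calculus.
Context {R : realType}.

Lemma diff_littleo (V W : normedModType R) (f : V -> W) x :
  differentiable f x -> forall e : R, 0 < e ->
  \forall w \near (0 : V), `|f (x + w) - f x - 'd f x w| <= e * `|w|.
Proof.
move=> /diff_locally /eqaddoP df e e0; have := df e e0; apply: filterS => w /=.
by rewrite !fctE /= opprD addrA (addrC w).
Qed.

Lemma cvg_is_derive (V W : normedModType R) (f : V -> W) x v df :
  h^-1 *: (f (h *: v + x) - f x) @[h --> (0 : R)^'] --> df -> is_derive x v f df.
Proof.
move=> fdf; split; first by apply/cvg_ex; exists df.
exact: cvg_lim.
Qed.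

Lemma diff_cvg (V W : normedModType R) (f : V -> W) x v : differentiable f x ->
  h^-1 *: (f (h *: v + x) - f x) @[h --> (0 : R)^'] --> 'd f x v.
Proof.
move=> fx; rewrite -deriveE//.
exact: (diff_derivable (v := v) fx).
Qed.

Lemma diff_line (V W : normedModType R) (f : V -> W) x v (t : R) :
  differentiable f (x + t *: v) ->
  is_derive t 1 (fun s => f (x + s *: v)) ('d f (x + t *: v) v).
Proof.
move=> /(@diff_cvg _ _ _ _ v) fx; apply: cvg_is_derive.
apply: cvg_trans fx; apply: near_eq_cvg; near=> h.
by rewrite [h *: 1]mulr1 scalerDl addrCA.
Unshelve. all: by end_near. Qed.

(** Polarization reduces the claim to continuity of the norm. *)
Lemma cvg_inner (V : hilbertVectType R) (T : Type) (F : set_system T)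
    (x y : T -> V) a b : Filter F -> x t @[t --> F] --> a -> y t @[t --> F] --> b ->
  '<<x t, y t>> @[t --> F] --> '<<a, b>>.
Proof.
move=> FF xa yb.
have pol (u v : V) : '<<u, v>> = (`|u + v| ^+ 2 - `|u - v| ^+ 2) / 4.
  rewrite !normr_inner innerBl innerDl !innerBr !innerDr (innerC v u).
  by field.
under eq_cvg do rewrite pol.
rewrite pol; apply: cvgM; last exact: cvg_cst.
have cvg_sqr (z : T -> V) c : z t @[t --> F] --> c ->
    `|z t| ^+ 2 @[t --> F] --> `|c| ^+ 2.
  move=> zc; rewrite expr2; under eq_cvg do rewrite expr2.
  by apply: cvgM; exact: cvg_norm.
by apply: cvgB; apply: cvg_sqr; [exact: cvgD|exact: cvgB].
Qed.

(* Both orders of the second difference of [F] along [u] and [v] evaluate, by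
   the mean value theorem, to [t ^ 2 <L v, u>] and [t ^ 2 <L u, v>] up to
   [o(t ^ 2)]. *)
Lemma gradient_diff_sym (V : hilbertVectType R) (F : V -> R) (G : V -> V) x0 :
  (forall x v (t : R), is_derive t 1 (fun s => F (x + s *: v)) '<<G (x + t *: v), v>>) ->
  differentiable G x0 ->
  forall u v, '<<'d G x0 u, v>> = '<<u, 'd G x0 v>>.
Proof.
move=> FG Gx0 u v.
set L := 'd G x0.
(* The added 1 makes [M] positive even when [u] and [v] vanish. *)
pose M := `|u| + `|v| + 1.
have M0 : 0 < M by rewrite ltr_wpDl ?addr_ge0.
pose Del (a b : V) (t : R) := F (x0 + t *: b + t *: a) - F (x0 + t *: a)
   - (F (x0 + t *: b) - F x0).
have key a b (e t : R) : 0 < e -> 0 < t -> `|a| + `|b| <= M ->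
    (forall w, `|w| <= t * M -> `|G (x0 + w) - G x0 - L w| <= e * `|w|) ->
    `|Del a b t - t ^+ 2 * '<<L b, a>>| <= 2 * e * t ^+ 2 * M ^+ 2.
  move=> e0 t0 abM Ge.
  (* The increment of [phi] from 0 to [t] is [Del a b t], and the derivative of [phi] is a
     difference of two values of [G] near [x0]. *)
  pose phi (s : R) := F ((x0 + t *: b) + s *: a) - F (x0 + s *: a).
  have dphi (s : R) : is_derive s 1 phi
      ('<<G ((x0 + t *: b) + s *: a), a>> - '<<G (x0 + s *: a), a>>).
    exact: is_deriveB.
  have [|s s01 phiE] := MVT t0 (fun s _ => dphi s).
    apply: continuous_subspaceT => s; apply: differentiable_continuous.
    by apply/derivable1_diffP; apply: ex_derive.
  have {phiE} -> : Del a b t =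
      ('<<G ((x0 + t *: b) + s *: a), a>> - '<<G (x0 + s *: a), a>>) * t.
    by rewrite -[X in _ * X]subr0 -phiE /phi /Del !scale0r !addr0.
  have /andP[s0 st] : 0 < s < t by move: s01; rewrite in_itv.
  have aM : `|a| <= M by apply: le_trans abM; rewrite lerDl.
  have ta : `|s *: a| <= t * M.
    rewrite normrZ gtr0_norm// ler_pM// ltW//.
  have tab : `|t *: b + s *: a| <= t * M.
    apply: le_trans (ler_normD _ _) _; rewrite !normrZ !gtr0_norm//.
    apply: le_trans (_ : t * `|b| + t * `|a| <= _).
      by rewrite lerD2l ler_wpM2r// ltW.
    by rewrite -mulrDr ler_wpM2l 1?addrC// ltW.
  have {Ge} := Ge; set D := fun w => G (x0 + w) - G x0 - L w => Ge.
  have GE w : G (x0 + w) = G x0 + L w + D w.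
    by rewrite /D -(addrA _ (- G x0)) -opprD [RHS]addrC subrK.
  rewrite -[x0 + t *: b + _]addrA !GE.
  have -> : ('<<G x0 + L (t *: b + s *: a) + D (t *: b + s *: a), a>> -
     '<<G x0 + L (s *: a) + D (s *: a), a>>) * t - t ^+ 2 * '<<L b, a>> =
     t * ('<<D (t *: b + s *: a), a>> - '<<D (s *: a), a>>).
    rewrite !innerDl (linearD L) (linearZ_LR L t b) !innerDl /= innerZl; ring.
  rewrite normrM gtr0_norm//.
  have -> : 2 * e * t ^+ 2 * M ^+ 2 = t * (e * (t * M) * M + e * (t * M) * M).
    by ring.
  rewrite ler_pM2l//; apply: le_trans (ler_normB _ _) _; apply: lerD.
    apply: le_trans (norm_CS _ _) _; apply: ler_pM => //.
    by apply: le_trans (Ge _ tab) _; rewrite ler_pM2l.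
  apply: le_trans (norm_CS _ _) _; apply: ler_pM => //.
  by apply: le_trans (Ge _ ta) _; rewrite ler_pM2l.
have DelC t : Del u v t = Del v u t.
  rewrite /Del (addrAC x0); lra.
apply/eqP; rewrite -subr_eq0 -normr_eq0 eq_le normr_ge0 andbT.
apply/ler_addgt0Pl => e' e'0; rewrite addr0.
(* Two applications of [key] each cost [2 * e * t ^+ 2 * M ^+ 2]; this [e] makes their sum
   [t ^+ 2 * e']. *)
pose e := e' / (4 * M ^+ 2).
have e0 : 0 < e by rewrite divr_gt0// mulr_gt0// exprn_gt0.
have /nbhs_ballP[d /= d0 dP] := diff_littleo Gx0 e0.
(* All displacements have length at most [t * M], that is [d / 2], inside the ball of radius [d]. *)
pose t := d / (2 * M).
have t0 : 0 < t by rewrite divr_gt0// mulr_gt0.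
have Gt w : `|w| <= t * M -> `|G (x0 + w) - G x0 - L w| <= e * `|w|.
  move=> wt; apply: dP; rewrite -ball_normE /ball_/= sub0r normrN.
  apply: le_lt_trans wt _; rewrite /t invfM mulrA mulfVK ?gt_eqF//; lra.
have uvM : `|u| + `|v| <= M by rewrite lerDl.
have vuM : `|v| + `|u| <= M by rewrite addrC.
have := key u v e t e0 t0 uvM Gt; have := key v u e t e0 t0 vuM Gt.
rewrite DelC (innerC u (L v)) => h1 h2.
have t20 : 0 < t ^+ 2 by rewrite exprn_gt0.
rewrite -(ler_pM2l t20) -[X in X * _](gtr0_norm t20) -normrM.
have -> : t ^+ 2 * ('<<L u, v>> - '<<L v, u>>) =
  (Del v u t - t ^+ 2 * '<<L v, u>>) - (Del v u t - t ^+ 2 * '<<L u, v>>) by ring.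
apply: le_trans (ler_normB _ _) _; apply: le_trans (lerD h2 h1) _.
rewrite le_eqVlt; apply/orP; left; apply/eqP.
by rewrite /e; field; rewrite gt_eqF.
Qed.

End Calculus.

(** * Derivative of the metric projection *)

Lemma jacE (R : realType) (V V' : hilbertVectType R) (f : V -> V') x d :
  jac f x d = 'd f x d.
Proof. exact: lfunE. Qed.

(* The two hypotheses are Moreau's characterization of the projection onto a
   self-dual cone. *)
Section ConeProjection.
Context {R : realType} {V : hilbertVectType R}.
Variable proj : V -> V.
Implicit Types u v b c : V.
Hypothesis proj_dual : forall u u', 0 <= '<<proj u, proj u' - u'>>.
Hypothesis proj_orth : forall u, '<<proj u, proj u - u>> = 0.

(** The right side minus the left is the sum of the two cross products of [proj_dual]; the diagonal
    products vanish by [proj_orth]. *)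
Lemma proj_firm u u' :
  '<<proj u - proj u', proj u - proj u'>> <= '<<proj u - proj u', u - u'>>.
Proof.
have := proj_dual u u'; have := proj_dual u' u.
have := proj_orth u; have := proj_orth u'.
rewrite !innerBl !innerBr; lra.
Qed.

Lemma proj_lip u u' : `|proj u - proj u'| <= `|u - u'|.
Proof.
have := proj_firm u u'; rewrite -[X in X <= _]normr_inner => h.
have {}h := le_trans h (le_trans (ler_norm _) (norm_CS _ _)).
have [->|n0] := eqVneq `|proj u - proj u'| 0; first exact: normr_ge0.
have n1 : 0 < `|proj u - proj u'| by rewrite lt_neqAle eq_sym n0 normr_ge0.
by rewrite -(ler_pM2l n1) -expr2.
Qed.

Lemma proj_continuous : continuous proj.
Proof.
move=> u; apply/cvgrPdist_le => e e0; near=> v.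
apply: le_trans (proj_lip _ _) _; near: v.
exact: cvgr_dist_le.
Unshelve. all: by end_near. Qed.

Let F v : R := '<<proj v, proj v>> / 2.

(** [proj] is a subgradient of [F] everywhere. The subgradient inequalities at [u] and at [u + b]
    enclose the gap between 0 and [<proj (u + b) - proj u, b>], which is quadratic in [b] by the
    Lipschitz bound. *)
Lemma proj_potential u b : 0 <= F (u + b) - F u - '<<proj u, b>> <= `|b| ^+ 2.
Proof.
(* By duality and orthogonality the difference is at least half the squared distance from [proj v]
   to [proj v']. *)
have sub v v' : 0 <= F v' - F v - '<<proj v, v' - v>>.
  have := proj_dual v v'; have := proj_orth v; have := proj_orth v'.
  have := inner_ge0 (proj v - proj v').
  rewrite inner_sqrB !innerBr (innerC (proj v) (proj v')) /F; lra.
have := sub u (u + b); rewrite [u + b - u]addrAC subrr add0r => -> /=.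
have := sub (u + b) u; rewrite opprD addrA subrr sub0r innerNr.
have : '<<proj (u + b) - proj u, b>> <= `|b| ^+ 2.
  apply: le_trans (ler_norm _) _; apply: le_trans (norm_CS _ _) _.
  rewrite expr2 ler_wpM2r//; apply: le_trans (proj_lip _ _) _.
  by rewrite [u + b - u]addrAC subrr add0r.
rewrite innerBl; lra.
Qed.

(** The quadratic bound on the gap makes [proj] the gradient of [F] at every point, including those
    where [proj] itself is not differentiable. *)
Lemma proj_line u b (t : R) :
  is_derive t 1 (fun s => F (u + s *: b)) '<<proj (u + t *: b), b>>.
Proof.
apply: cvg_is_derive; apply/cvgrPdist_le => e e0; near=> h.
have h0 : h != 0 by near: h; exact: nbhs_dnbhs_neq.
rewrite [h *: 1]mulr1 scalerDl addrCA.
set v := u + t *: b; have /andP[] := proj_potential v (h *: b).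
set d := _ - _ - _ => l r.
have -> : F (h *: b + v) - F v = d + h * '<<proj v, b>>.
  by rewrite /d innerZr subrK (addrC v).
rewrite [_ *: _]mulrDr mulKf// opprD addrCA subrr addr0 normrN normrM normfV.
rewrite ler_pdivrMl ?normr_gt0// (ger0_norm l); apply: le_trans r _.
rewrite normrZ exprMn expr2 -mulrA ler_pM2l ?normr_gt0//.
have hB : `|h| * (`|b| ^+ 2 + 1) <= e.
  rewrite -ler_pdivlMr ?ltr_wpDl ?sqr_ge0//.
  near: h; apply: dnbhs0_le; rewrite divr_gt0// ltr_wpDl ?sqr_ge0//.
by apply: le_trans hB; rewrite ler_wpM2l// lerDl.
Unshelve. all: by end_near. Qed.

Lemma cvg_diffquot_id u b :
  (fun h : R => h^-1 *: ((h *: b + u) - u)) @ (0 : R)^' --> b.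
Proof.
apply: cvg_near_cst; near=> h.
have h0 : h != 0 by near: h; exact: nbhs_dnbhs_neq.
by rewrite addrK scalerA mulVf// scale1r.
Unshelve. all: by end_near. Qed.

Lemma jac_proj_firm u b : differentiable proj u ->
  '<<jac proj u b, jac proj u b>> <= '<<jac proj u b, b>>.
Proof.
move=> /(diff_cvg (v := b)) du; rewrite jacE.
apply: ler_cvg_to (cvg_inner _ du du) (cvg_inner _ du (@cvg_diffquot_id u b)) _.
near=> h; rewrite !innerZl !innerZr !mulrA ler_wpM2l -?expr2 ?sqr_ge0//.
exact: proj_firm.
Unshelve. all: by end_near. Qed.

(** The derivative of [proj] is a second derivative of [F]. *)
Lemma jac_proj_sym u b c : differentiable proj u ->
  '<<jac proj u b, c>> = '<<b, jac proj u c>>.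
Proof.
move=> du; rewrite !jacE; apply: (gradient_diff_sym (F := F)) => // *.
exact: proj_line.
Qed.

End ConeProjection.

(** Read [b] and [a] as the projections of [c] and [d + c]: this is the product rule for
    complementarity, as an exact identity between finite differences. *)
Lemma mulmx_sub0_diff (R : pzRingType) n (a b c d : 'M[R]_n) :
  b *m (b - c) = 0 -> a *m (a - (d + c)) = 0 ->
  (a - b) *m (a - (d + c)) + b *m (a - b) = b *m d.
Proof.
move=> bc ac; rewrite mulmxBl ac sub0r -mulmxN -mulmxDr opprB addrA subrK.
have -> : d + c - b = d - (b - c) by rewrite opprB addrA.
by rewrite mulmxBr bc subr0.
Qed.

Section ProjDeriv.
Context {R : realType} {p : nat}.
Local Notation S := (symmx R p).
Implicit Types Z U N A B C : S.
Local Notation proj := (@metric_proj R S psd).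

Lemma metric_projP U : let Z := proj U in
  [/\ psd Z, psd (Z - U), '<<Z, Z - U>> = 0
    & mx_of_sym Z *m mx_of_sym (Z - U) = 0].
Proof.
have [P [rho UP]] := spectral_exists U.
have [ZE NE Z0 N0 ZN] := metric_proj_spectral UP.
split=> //; rewrite ZE NE; case: UP => PP _ _.
rewrite -!mulmxA (mulmxA P^T) PP mul1mx (mulmxA (diag_mx _)) mulmx_diag.
rewrite (_ : \row_j _ = 0) ?linear0 ?mul0mx ?mulmx0//.
apply/rowP => j; rewrite !mxE.
case: (lerP 0 (rho 0 j)) => r0; last by rewrite mul0r.
by rewrite [Num.max (- _) _]max_r ?oppr_le0// mulr0.
Qed.

(** [E] is the symmetrised outer product of [v] and [w]. Entries and forms of a symmetric matrix
    thus become inner products, and inherit convergence from the norm of the space. *)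
Lemma mxform_innerE (v w : 'cV[R]_p) :
  exists E : S, forall Z, mxform (mx_of_sym Z) v w = '<<Z, E>>.
Proof.
pose M : 'M[R]_p := 2^-1 *: (w *m v^T + v *m w^T).
have [|E EM] := @mx_of_sym_surj R p M.
  by rewrite /M linearZ/= linearD/= !trmx_mul !trmxK addrC.
exists E => Z; rewrite sym_innerE EM /M -scalemxAr mxtraceZ mulmxDr mxtraceD.
have tr u u' : \tr (mx_of_sym Z *m (u *m u'^T)) = mxform (mx_of_sym Z) u' u.
  by rewrite mulmxA mxtrace_mulC mulmxA /mxtrace big_ord1.
by rewrite !tr (mxformC w v (mx_of_symT Z)); field.
Qed.

Lemma cvg_mulmx (T : Type) (F : set_system T) (A B : T -> S) a b i j :
  Filter F -> A t @[t --> F] --> a -> B t @[t --> F] --> b ->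
  (mx_of_sym (A t) *m mx_of_sym (B t)) i j @[t --> F] -->
  (mx_of_sym a *m mx_of_sym b) i j.
Proof.
move=> FF Aa Bb.
have entry (C : T -> S) c i' j' : C t @[t --> F] --> c ->
    mx_of_sym (C t) i' j' @[t --> F] --> mx_of_sym c i' j'.
  move=> Cc; have [E HE] := mxform_innerE (delta_mx i' 0) (delta_mx j' 0).
  rewrite -mxform_delta HE; under eq_cvg do rewrite -mxform_delta HE.
  by apply: cvg_inner => //; exact: cvg_cst.
rewrite mxE; under eq_cvg do rewrite mxE.
by apply: cvg_sumr => k; apply: cvgM; exact: entry.
Qed.

(* What survives in the limit from the derivative of the projection at a point
   [U] with [Z = proj U], [N = Z - U]: the first equation is the derivative of
   [Z *m (Z - U) = 0]. *)
Definition proj_differential (Z N : S) (W : 'End(S)) : Prop :=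
  [/\ forall B, mx_of_sym (W B) *m mx_of_sym N + mx_of_sym Z *m mx_of_sym (W B)
        = mx_of_sym Z *m mx_of_sym B,
      forall B, '<<W B, W B>> <= '<<W B, B>>
    & forall B C, '<<W B, C>> = '<<B, W C>>].

Lemma metric_proj_dual U U' : 0 <= '<<proj U, proj U' - U'>>.
Proof. by apply: psd_inner_ge0; [case: (metric_projP U)|case: (metric_projP U')]. Qed.

Lemma metric_proj_orth U : '<<proj U, proj U - U>> = 0.
Proof. by case: (metric_projP U). Qed.

Lemma jac_metric_proj U : differentiable proj U ->
  proj_differential (proj U) (proj U - U) (jac proj U).
Proof.
move=> dU; split=> [B|B|B C]; last 2 first.
- by apply: jac_proj_firm => //; [exact: metric_proj_dual|exact: metric_proj_orth].
- by apply: jac_proj_sym => //; [exact: metric_proj_dual|exact: metric_proj_orth].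
have YB := diff_cvg (v := B) dU.
have hB : h *: B + U @[h --> (0 : R)^'] --> U.
  rewrite -[X in _ --> X]add0r -[X in _ --> X + _](scale0r B).
  apply: cvgD; last exact: cvg_cst.
  by apply: cvgZr_tmp; exact: nbhs_dnbhs.
have projB : proj (h *: B + U) @[h --> (0 : R)^'] --> proj U.
  apply: (cvg_comp _ _ hB).
  exact: (proj_continuous metric_proj_dual metric_proj_orth).
rewrite jacE; apply/matrixP => i j; apply/eqP; rewrite -subr_eq0; apply/eqP.
have FF : Filter (0 : R)^' by exact: dnbhs_filter.
(* Left side minus right side is the limit of the same expression in difference quotients, and that
   expression is zero for every [h != 0]. *)
have lim1 := cvg_mulmx (i := i) (j := j) _ YB (cvgB projB hB).
have lim2 := cvg_mulmx (i := i) (j := j) _ (cvg_cst (proj U)) YB.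
have lim3 := cvg_mulmx (i := i) (j := j) _ (cvg_cst (proj U)) (@cvg_diffquot_id R S U B).
have lim := cvgB (cvgD (lim1 FF FF) (lim2 FF FF)) (lim3 FF FF).
rewrite [X in X - _]mxE; rewrite -[LHS](cvg_lim (@Rhausdorff R) (lim FF FF)).
apply: cvg_lim => //.
apply: cvg_near_cst; near=> h.
have h0 : h != 0 by near: h; exact: nbhs_dnbhs_neq.
have [_ _ _] := metric_projP U; have [_ _ _] := metric_projP (h *: B + U).
set Z' := proj (h *: B + U); set Z := proj U => ZN' ZN.
have key : mx_of_sym (h^-1 *: (Z' - Z)) *m mx_of_sym (Z' - (h *: B + U)) +
    mx_of_sym Z *m mx_of_sym (h^-1 *: (Z' - Z)) =
    mx_of_sym Z *m mx_of_sym (h^-1 *: (h *: B + U - U)).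
  have mxZ c (Q : S) : mx_of_sym (c *: Q) = c *: mx_of_sym Q by exact: linearZ.
  rewrite !mxZ -scalemxAl -!scalemxAr -scalerDr; congr (_ *: _).
  have mxB (Q Q' : S) : mx_of_sym (Q - Q') = mx_of_sym Q - mx_of_sym Q'.
    exact: linearB.
  have mxD (Q Q' : S) : mx_of_sym (Q + Q') = mx_of_sym Q + mx_of_sym Q'.
    exact: linearD.
  move: ZN ZN'; rewrite addrK !mxB mxD mxZ; exact: mulmx_sub0_diff.
have := congr1 (fun M : 'M_p => M i j) key; rewrite [X in X = _]mxE => H.
by apply/eqP; rewrite subr_eq0; apply/eqP.
Unshelve. all: by end_near. Qed.

(** All three clauses hold at each [u_ k] and are closed under limits, since the projection is
    continuous. *)
Lemma B_subdiff_metric_proj U W : B_subdiff proj U W ->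
  proj_differential (proj U) (proj U - U) W.
Proof.
move=> [u_ [du uU uW]].
have JW B : jac proj (u_ k) B @[k --> \oo] --> W B.
  apply/cvgrPdist_le => e e0.
  have B1 : 0 < `|B| + 1 by rewrite ltr_wpDl.
  have := uW _ (divr_gt0 e0 B1); apply: filterS => k /(_ B); rewrite distrC.
  move=> /le_trans; apply; rewrite mulrAC ler_pdivrMr// ler_wpM2l ?ltW//.
  by rewrite ltrDl.
have Zu : proj (u_ k) @[k --> \oo] --> proj U.
  apply: (cvg_comp _ _ uU).
  exact: (proj_continuous metric_proj_dual metric_proj_orth).
have P k := jac_metric_proj (du k).
have FF : Filter (\oo : set_system nat) by exact: _.
split=> [B|B|B C].
- apply/matrixP => i j.
  have lim1 := cvg_mulmx (i := i) (j := j) _ (JW B) (cvgB Zu uU).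
  have lim2 := cvg_mulmx (i := i) (j := j) _ Zu (JW B).
  have lim3 := cvg_mulmx (i := i) (j := j) _ Zu (cvg_cst B).
  rewrite mxE -(cvg_lim (@Rhausdorff R) (cvgD (lim1 FF FF) (lim2 FF))).
  apply: cvg_lim => //; apply: cvg_trans (lim3 FF FF); apply: near_eq_cvg; near=> k.
  have [+ _ _] := P k => /(_ B) E.
  by have := congr1 (fun M : 'M_p => M i j) E; rewrite [X in X = _]mxE.
- apply: ler_cvg_to (cvg_inner _ (JW B) (JW B)) (cvg_inner _ (JW B) (cvg_cst B)) _.
  by near=> k; have [_ + _] := P k; apply.
- rewrite -(cvg_lim (@Rhausdorff R) (cvg_inner _ (JW B) (cvg_cst C))).
  apply: cvg_lim => //; apply: cvg_trans (cvg_inner _ (cvg_cst B) (JW C)).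
  by apply: near_eq_cvg; near=> k; have [_ _ ->] := P k.
Unshelve. all: by end_near. Qed.

End ProjDeriv.

(** * Lagrangian *)

Section LinearForms.
Context {R : realType} {V : hilbertVectType R}.
Implicit Types (a x v : V).

Definition inner_form a : V -> R^o := fun v => '<<a, v>>.

Fact inner_form_linear a : linear (inner_form a).
Proof. by move=> c x y; rewrite /inner_form innerDr innerZr. Qed.

HB.instance Definition _ a :=
  GRing.isLinear.Build R V R^o *:%R (inner_form a) (inner_form_linear a).

Lemma inner_form_continuous a : continuous (inner_form a).
Proof. by move=> x; apply: cvg_inner; [exact: cvg_cst|exact: cvg_id]. Qed.

Lemma diff_inner (U : normedModType R) (f : U -> V) a (x : U) : differentiable f x ->
  differentiable (fun y => '<<a, f y>> : R) x /\
  forall d, 'd (fun y => '<<a, f y>> : R) x d = '<<a, 'd f x d>>.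
Proof.
move=> fx; have la y : differentiable (inner_form a) y.
  exact/linear_differentiable/inner_form_continuous.
split; first exact: (differentiable_comp fx (la _)).
move=> d; have := diff_comp fx (la _) => /(congr1 (fun h => h d)) /=.
by rewrite (diff_lin _ (@inner_form_continuous a)).
Qed.

(** The [e i] represent the coordinate forms of a basis; they reduce questions of continuity,
    compactness and differentiability in [V] to scalar ones. *)
Lemma dual_basis : exists (n : nat) (e b : 'I_n -> V),
  forall v, v = \sum_i '<<e i, v>> *: b i.
Proof.
pose n := \dim {: V}; pose b := vbasis {: V}.
have [e eP] := choice (fun i => riesz (coord b i)).
exists n, e, (fun i => b`_i) => v.
by rewrite {1}(coord_vbasis (memvf v)); apply: eq_bigr => i _; rewrite eP.
Qed.

Lemma diff_of_inner (U : normedModType R) (G : U -> V) (x : U) :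
  (forall d, differentiable (fun y => '<<d, G y>> : R) x) -> differentiable G x.
Proof.
move=> Gd; have [n [e [b bE]]] := dual_basis.
rewrite (_ : G = \sum_i (fun y => '<<e i, G y>> *: b i)).
  apply: differentiable_sum => i.
  exact: (@differentiableZl _ _ _ (fun y => '<<e i, G y>> : R)).
by apply/funext => y; rewrite fct_sumE -bE.
Qed.

(** The products of the gradient with fixed vectors are the directional derivatives of [F], so their
    differentiability at [x] gives that of the gradient, and the symmetry of second differences
    applies. *)
Lemma hessian_sym (F : V -> R) x :
  (forall y, differentiable F y) ->
  (forall d, differentiable (fun y => 'd F y d) x) ->
  forall u v, '<<hessian F x u, v>> = '<<u, hessian F x v>>.
Proof.
move=> dF ddF u v; rewrite /hessian !jacE.
apply: (gradient_diff_sym (F := F)) => [y w t|].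
  by rewrite -gradP; exact: diff_line.
apply: diff_of_inner => d; rewrite (_ : (fun _ => _) = (fun y => 'd F y d))//.
by apply/funext => y; rewrite gradP innerC.
Qed.

End LinearForms.

Section Lagrangian.
Context {R : realType} {X : hilbertVectType R} {m p : nat}.
Variables (f : X -> R) (h : X -> evec R m) (g : X -> symmx R p).
Hypotheses (f_C2 : is_C2 f) (h_C2 : is_C2 h) (g_C2 : is_C2 g).
Implicit Types (lm : evec R m * symmx R p) (x d : X).

Lemma diff_lagrangian lm x : differentiable (lagrangian f h g lm) x /\
  forall d, 'd (lagrangian f h g lm) x d =
    'd f x d - '<<lm.1, 'd h x d>> - '<<lm.2, 'd g x d>>.
Proof.
have [[fd _] _] := f_C2; have [[hd _] _] := h_C2; have [[gd _] _] := g_C2.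
have [hd1 hd2] := diff_inner lm.1 (hd x); have [gd1 gd2] := diff_inner lm.2 (gd x).
have fhd : differentiable (fun y => f y - '<<lm.1, h y>> : R) x.
  exact: (differentiableB (fd x) hd1).
split=> [|d]; first exact: (differentiableB fhd gd1).
have E1 : 'd (lagrangian f h g lm) x d = 'd (fun y => f y - '<<lm.1, h y>> : R) x d
    - 'd (fun y => '<<lm.2, g y>> : R) x d.
  exact: (congr1 (fun k : X -> R => k d) (diffB fhd gd1)).
have E2 : 'd (fun y => f y - '<<lm.1, h y>> : R) x d = 'd f x d
    - 'd (fun y => '<<lm.1, h y>> : R) x d.
  exact: (congr1 (fun k : X -> R => k d) (diffB (fd x) hd1)).
exact: (etrans E1 (congr2 (fun a b : R => a - b)
  (etrans E2 (congr1 (fun b : R => 'd f x d - b) (hd2 d))) (gd2 d))).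
Qed.

Lemma hessian_lagrangian_sym lm x u v :
  '<<hessian (lagrangian f h g lm) x u, v>> =
  '<<u, hessian (lagrangian f h g lm) x v>>.
Proof.
apply: hessian_sym => [y|d]; first by case: (diff_lagrangian lm y).
rewrite (_ : (fun _ => _) =
  (fun y => 'd f y d - '<<lm.1, 'd h y d>> - '<<lm.2, 'd g y d>>)).
  have [_ /(_ d)[fd _]] := f_C2; have [_ /(_ d)[hd _]] := h_C2.
  have [_ /(_ d)[gd _]] := g_C2.
  have [hd1 _] := diff_inner lm.1 (hd x); have [gd1 _] := diff_inner lm.2 (gd x).
  exact: (differentiableB (differentiableB (fd x) hd1) gd1).
by apply/funext => y; case: (diff_lagrangian lm y).
Qed.

Lemma grad_lagrangian lm x d : '<<grad (lagrangian f h g lm) x, d>> =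
  '<<grad f x, d>> - '<<lm.1, jac h x d>> - '<<lm.2, jac g x d>>.
Proof.
have [_ E] := diff_lagrangian lm x.
exact: (etrans (esym (gradP (lagrangian f h g lm) x d)) (etrans (E d)
  (congr2 (fun a b : R => a - b) (congr2 (fun a b : R => a - b) (gradP f x d)
    (congr1 (inner lm.1) (esym (jacE h x d))))
    (congr1 (inner lm.2) (esym (jacE g x d)))))).
Qed.

End Lagrangian.

(** * Nondegeneracy *)

Section Nondegeneracy.
Context {R : realType} {p : nat}.
Local Notation S := (symmx R p).
Implicit Types A B G Z M : S.

(** By Moreau's criterion [A] and [B] are the two parts of [A - B]; a vanishing inner product
    thereby improves to a vanishing matrix product. *)
Lemma psd_orth A B : psd A -> psd B -> '<<A, B>> = 0 ->
  metric_proj psd (A - B) = A /\ mx_of_sym A *m mx_of_sym B = 0.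
Proof.
move=> A0 B0 AB.
have E : A - (A - B) = B by rewrite opprB addrC subrK.
have PA : metric_proj psd (A - B) = A by apply: metric_proj_psd_eq; rewrite ?E.
by split=> //; case: (metric_projP (A - B)); rewrite PA E.
Qed.

(** At a kernel vector of [G] the form of [G + t k *: d_ k] is [t k] times that of [d_ k], so the
    latter is nonnegative, and so is its limit. *)
Lemma tangent_psd_ge0 G B v : tangent_cone psd G B -> mx_of_sym G *m v = 0 ->
  0 <= mxform (mx_of_sym B) v v.
Proof.
move=> [t [d_ [t0 _ dB Gtd]]] Gv; have [E EE] := mxform_innerE v v; rewrite EE.
have lim := cvg_inner _ dB (cvg_cst E).
apply: ler_cvg_to (cvg_cst (0 : R)) (lim _ _) _; near=> k; rewrite -EE.
have := Gtd k v; rewrite -[X in 0 <= X]/(mxform _ v v).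
have -> : mx_of_sym (G + t k *: d_ k) = mx_of_sym G + t k *: mx_of_sym (d_ k).
  by rewrite linearD; congr (_ + _); exact: linearZ.
by rewrite mxformD mxformZ {1}/mxform -mulmxA Gv mulmx0 mxE add0r pmulr_rge0.
Unshelve. all: by end_near. Qed.

(** Eigenvectors of [Z] with nonzero eigenvalue lie in the kernel of [G]. There [B] and [- B] are
    both tangent, so the form of [B] vanishes and every term of the trace is zero. No sign of [Z]
    enters. *)
Lemma lineality_orth G Z B : mx_of_sym Z *m mx_of_sym G = 0 ->
  lineality (tangent_cone psd G) B -> '<<Z, B>> = 0.
Proof.
move=> ZG [L LT /= BL].
have TB : tangent_cone psd G B by exact: LT.
have TNB : tangent_cone psd G (- B) by apply: LT; rewrite /= rpredN.
have [P [a ZPa]] := spectral_exists Z; have [PP _ ZE] := ZPa.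
rewrite sym_innerE ZE mxtrace_spectral big1// => i _.
have [->|a0] := eqVneq (a 0 i) 0; first by rewrite mul0r.
have Gi : mx_of_sym G *m (P *m delta_mx i (0 : 'I_1)) = 0.
  have : mx_of_sym G *m mx_of_sym Z *m (P *m delta_mx i (0 : 'I_1)) = 0.
    have -> : mx_of_sym G *m mx_of_sym Z = 0.
      by apply: trmx_inj; rewrite trmx_mul !mx_of_symT ZG trmx0.
    by rewrite mul0mx.
  rewrite ZE -!mulmxA (mulmxA P^T) PP mul1mx.
  have -> : diag_mx a *m delta_mx i (0 : 'I_1) = a 0 i *: delta_mx i 0.
    apply/colP => j; rewrite mul_diag_mx !mxE.
    by have [->|] := eqVneq j i; rewrite ?mulr0.
  by rewrite -!scalemxAr => /eqP; rewrite scaler_eq0 (negPf a0) => /eqP.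
apply/eqP; rewrite mulf_eq0 (negPf a0) eq_le (tangent_psd_ge0 TB Gi) andbT.
by have := tangent_psd_ge0 TNB Gi; rewrite linearN/= -scaleN1r mxformZ mulN1r oppr_ge0.
Qed.

(** Nondegeneracy writes [(z, Z)] itself as [(jac h x d, jac g x d + B)]; pairing it with [(z, Z)]
    leaves [<Z, B>], which is zero. *)
Lemma psd_lineality_nondegenerate (X : hilbertVectType R) m (h : X -> evec R m)
    (g : X -> S) x (z : evec R m) Z : constraint_nondegenerate h g x ->
  (forall d, '<<z, jac h x d>> + '<<Z, jac g x d>> = 0) ->
  mx_of_sym Z *m mx_of_sym (g x) = 0 -> z = 0 /\ Z = 0.
Proof.
move=> nd zZ Zg; have : [set: evec R m * S] (z, Z) by [].
rewrite -nd => -[d _ [B BL [zE ZE]]].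
have : '<<z, z>> + '<<Z, Z>> = 0.
  rewrite -{2}zE -{2}ZE innerDr addrA zZ add0r.
  exact: lineality_orth BL.
have := inner_ge0 z; have := inner_ge0 Z => Z0 z0 /eqP.
by rewrite paddr_eq0// => /andP[/eqP/inner_eq0 -> /eqP/inner_eq0 ->].
Qed.

(** The pseudo-inverse [Y] of a semidefinite [g] is symmetric and equals [Y *m g *m Y], hence is
    semidefinite, and so is its conjugate by [a]. *)
Lemma Upsilon_ge0 G M A : psd G -> psd M -> 0 <= Upsilon G M A.
Proof.
move=> G0 M0; rewrite /Upsilon mulr_ge0// mx_of_symT.
apply: psd_trace_ge0; [exact: mx_of_symT|exact: M0|].
set g := mx_of_sym G; set a := mx_of_sym A.
suff Y0 v : 0 <= mxform (mp_inv g) v v.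
  have aT : a^T = a := mx_of_symT A.
  by move=> v; rewrite -{1}aT -mxform_conj.
(* In the second case [xget] returns its default 0, whose form vanishes. *)
rewrite /mp_inv; case: xgetP => [Y _ [YA YB YC YD]|_]; last first.
  by rewrite /mxform mulmx0 mul0mx mxE.
have gs : g^T = g := mx_of_symT G.
(* Transposing the Penrose equations shows that [Y] commutes with [g]; this turns [Y^T *m g *m Y^T]
   into [Y *m g *m Y]. *)
have YT : Y^T = Y.
  have := congr1 trmx YA; rewrite !trmx_mul gs mulmxA => YA'.
  have gY : Y^T *m g = g *m Y by rewrite -YC trmx_mul gs.
  have Yg : g *m Y^T = Y *m g by rewrite -YD trmx_mul gs.
  have gYC : g *m Y = Y *m g.
    transitivity (g *m Y^T *m (g *m Y)); first by rewrite mulmxA YA'.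
    by rewrite Yg -gY -mulmxA [g *m _]mulmxA YA'.
  have := congr1 trmx YB; rewrite !trmx_mul gs mulmxA => YTB.
  by rewrite -YTB gY gYC -mulmxA Yg -gYC mulmxA YB.
by rewrite -YB -{1}YT -mxform_conj; exact: G0.
Qed.
End Nondegeneracy.

(** * Finsler's lemma *)

Section FiniteDim.
Context {R : realType} {V : hilbertVectType R}.
Implicit Types x y : V.

Lemma lfun_continuous (W : hilbertVectType R) (L : 'Hom(V, W)) : continuous L.
Proof.
have [n [e [b bE]]] := @dual_basis R V.
rewrite (_ : (L : V -> W) = fun x => \sum_i '<<e i, x>> *: L (b i)); last first.
  apply/funext => x; rewrite {1}(bE x) linear_sum.
  by apply: eq_bigr => i _; rewrite linearZ.
move=> x; apply: cvg_big => [|i _].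
  exact: (@pseudometric_normed_Zmodule.add_continuous R W).
by apply: cvgZr_tmp; apply: cvg_inner; [exact: cvg_cst|exact: cvg_id].
Qed.

(** A closed subset of the continuous image of a coordinate box; by Cauchy-Schwarz the coordinates
    of a unit vector are bounded by the norms of the [e i]. *)
Lemma compact_sphere : compact [set x : V | `|x| = 1].
Proof.
have [n [e [b bE]]] := @dual_basis R V.
pose phi (u : 'rV[R]_n) : V := \sum_i u 0 i *: b i.
have phic : continuous phi.
  suff phiF (F : set_system 'rV[R]_n) (u : 'rV[R]_n) : Filter F ->
      (forall i, (fun w : 'rV[R]_n => w 0 i) @ F --> u 0 i) -> phi w @[w --> F] --> phi u.
    by move=> u; apply: (phiF (nbhs u)) => i; exact: coord_continuous.
  move=> FF Fu; apply: cvg_big => [|i _]; last exact: cvgZr_tmp.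
  exact: (@pseudometric_normed_Zmodule.add_continuous R V).
pose K := [set u : 'rV[R]_n | forall i, `[- `|e i|, `|e i|]%classic (u 0 i)].
have Kc : compact K.
  apply: (@rV_compact R n (fun i => `[- `|e i|, `|e i|]%classic)) => i.
  exact: segment_compact.
apply: (@subclosed_compact _ _ (phi @` K)).
- rewrite (_ : [set x | _] = (fun x : V => `|x|) @^-1` [set 1])//.
  by apply: closed_comp => [x _|]; [exact: norm_continuous|exact: closed_eq].
- by apply: continuous_compact => //; exact: continuous_subspaceT.
move=> x /= x1; exists (\row_i '<<e i, x>>).
  move=> i /=; rewrite mxE in_itv/= -ler_norml.
  by apply: le_trans (norm_CS _ _) _; rewrite x1 mulr1.
by rewrite /phi [RHS]bE; apply: eq_bigr => i _; rewrite mxE.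
Qed.

(** By homogeneity it suffices to treat the unit sphere. On its compact part where [h <= 0], [q] has
    a positive minimum, so a large multiple of [q] outweighs [h]; increasing [c] further only helps,
    as [q] is nonnegative. *)
Lemma finsler (h q : V -> R) : continuous h -> continuous q ->
  (forall a x, h (a *: x) = a ^+ 2 * h x) ->
  (forall a x, q (a *: x) = a ^+ 2 * q x) ->
  (forall x, 0 <= q x) -> (forall x, x != 0 -> q x = 0 -> 0 < h x) ->
  exists c0 eta : R, [/\ 0 < c0, 0 < eta & forall c x, c0 <= c ->
    eta * `|x| ^+ 2 <= h x + c * q x].
Proof.
move=> hc qc hZ qZ q0 hq.
have r0 (r : V -> R) : (forall a x, r (a *: x) = a ^+ 2 * r x) -> r 0 = 0.
  by move=> rZ; rewrite -(scale0r (0 : V)) rZ expr2 !mul0r.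
have [[y y0]|V0] := pselect (exists x : V, x != 0); last first.
  exists 1, 1; split=> // c x _.
  have -> : x = 0 by apply/eqP; apply: contra_notT V0 => x0; exists x.
  by rewrite (r0 h)// (r0 q)// normr0 expr2 !mulr0 addr0.
pose K := [set x : V | `|x| = 1].
have Kn0 x : K x -> x != 0.
  by move=> x1; rewrite -normr_eq0 x1 oner_eq0.
have unit x : x != 0 -> K (`|x|^-1 *: x).
  by move=> x0; rewrite /K/= normrZ normfV normr_id mulVf// normr_eq0.
have Kne : K !=set0 by exists (`|y|^-1 *: y); exact: unit.
have min (A : set V) (r : V -> R) : A !=set0 -> compact A -> continuous r ->
    exists2 c, A c & forall x, A x -> r c <= r x.
  move=> A0 Ac rc.
  have [|c /[!inE] cA cmin] := compact_EVT_min A0 Ac (f := r).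
    exact: continuous_subspaceT.
  by exists c => // x xA; apply: cmin; rewrite inE.
have [c0 [c00 c0P]] : exists c0 : R, 0 < c0 /\ forall x, K x -> 0 < h x + c0 * q x.
  pose A := K `&` [set x | h x <= 0].
  have Ac : compact A.
    apply: (@subclosed_compact _ _ K) => [||x []//]; last exact: compact_sphere.
    apply: closedI; first exact: compact_closed (@norm_hausdorff _ _) compact_sphere.
    apply: (@closed_comp _ _ h [set r | r <= 0]) => [x _|]; [exact: hc|exact: closed_le].
  have [[z zA]|A0] := pselect (A !=set0); last first.
    exists 1; split=> // x Kx; rewrite mul1r ltr_wpDr// ltNge.
    by apply/negP => hx; apply: A0; exists x.
  have [a [Ka ha] amin] := min A q (ex_intro _ z zA) Ac qc.
  have [b Kb bmin] := min K h Kne compact_sphere hc.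
  have qa : 0 < q a.
    rewrite lt_neqAle q0 andbT eq_sym; apply/eqP => /(hq _ (Kn0 _ Ka)).
    by rewrite ltNge ha.
  (* With [a] minimising [q] where [h <= 0] and [b] minimising [h] on the sphere, this constant
     times [q x] is at least [|h b| + 1], which exceeds [- h x]. *)
  have c00 : 0 < (`|h b| + 1) / q a by rewrite divr_gt0// ltr_wpDl.
  exists ((`|h b| + 1) / q a); split=> // x Kx.
  have [hx|hx] := ltP 0 (h x); first by rewrite ltr_pwDl// mulr_ge0// ltW.
  have : (`|h b| + 1) / q a * q a <= (`|h b| + 1) / q a * q x.
    by rewrite ler_pM2l//; apply: amin.
  rewrite divfK ?gt_eqF//; have := bmin _ Kx; have := ler_norm (- h b).
  rewrite normrN; lra.
have [b Kb bmin] : exists2 b, K b & forall x, K x -> h b + c0 * q b <= h x + c0 * q x.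
  apply: (min K (fun x => h x + c0 * q x)) => //; first exact: compact_sphere.
  by move=> x; apply: cvgD; [exact: hc|apply: cvgM; [exact: cvg_cst|exact: qc]].
exists c0, (h b + c0 * q b); split=> // [|c x cc0]; first exact: c0P.
have [->|x0] := eqVneq x 0.
  by rewrite (r0 h)// (r0 q)// normr0 expr2 !mulr0 addr0.
apply: (@le_trans _ _ (h x + c0 * q x)); last by rewrite lerD2l ler_wpM2r.
have xE : x = `|x| *: (`|x|^-1 *: x) by rewrite scalerA divff ?scale1r// normr_eq0.
have hE : h x = `|x| ^+ 2 * h (`|x|^-1 *: x) by rewrite -hZ -xE.
have qE : q x = `|x| ^+ 2 * q (`|x|^-1 *: x) by rewrite -qZ -xE.
rewrite hE qE (mulrCA c0) -mulrDr mulrC ler_wpM2l ?sqr_ge0//.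
exact/bmin/unit.
Qed.

End FiniteDim.

(** * The augmented operator *)

Section BlockBound.
Context {R : realType} {p : nat}.
Local Notation S := (symmx R p).
Implicit Types (B G M : S) (W : 'End(S)) (P : 'M[R]_p) (rho : 'rV[R]_p).

(* The entries of [P^T B P] that have to vanish for [B = Jg d], [d] in [app]:
   rows in gamma, columns in beta or gamma. *)
Definition gamma_block (rho : 'rV[R]_p) (ij : 'I_p * 'I_p) : bool :=
  (rho 0 ij.1 < 0) && (rho 0 ij.2 <= 0).

Definition block_norm2 P rho B : R :=
  \sum_(ij | gamma_block rho ij) (P^T *m mx_of_sym B *m P) ij.1 ij.2 ^+ 2.

Lemma mxtrace_sqr (A : 'M[R]_p) : \tr (A^T *m A) = \sum_ij A ij.1 ij.2 ^+ 2.
Proof.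
rewrite -(pair_bigA _ (fun i j => A i j ^+ 2))/= exchange_big; apply: eq_bigr => i _.
by rewrite mxE; apply: eq_bigr => j _; rewrite mxE expr2.
Qed.

(** Orthogonal conjugation preserves the Frobenius norm, and the omitted entries contribute
    squares. *)
Lemma block_norm2_le P rho B : P^T *m P = 1%:M ->
  block_norm2 P rho B <= '<<B, B>>.
Proof.
move=> PP; have -> : '<<B, B>> = \sum_ij (P^T *m mx_of_sym B *m P) ij.1 ij.2 ^+ 2.
  rewrite -mxtrace_sqr sym_innerE !trmx_mul trmxK mx_of_symT.
  rewrite !mulmxA -[_ *m P *m P^T]mulmxA (mulmx1C PP) mulmx1.
  by rewrite [RHS]mxtrace_mulC !mulmxA (mulmx1C PP) mul1mx.
rewrite (bigID (gamma_block rho))/= lerDl.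
by apply: sumr_ge0 => ij _; exact: sqr_ge0.
Qed.

Lemma block_norm2Z P rho a B :
  block_norm2 P rho (a *: B) = a ^+ 2 * block_norm2 P rho B.
Proof.
rewrite /block_norm2 mulr_sumr; apply: eq_bigr => ij _.
have -> : mx_of_sym (a *: B) = a *: mx_of_sym B by exact: linearZ.
by rewrite -scalemxAr -scalemxAl mxE exprMn.
Qed.

Lemma block_norm2_ge0 P rho B : 0 <= block_norm2 P rho B.
Proof. by apply: sumr_ge0 => ij _; exact: sqr_ge0. Qed.

Lemma cvg_block_norm2 (T : Type) (F : set_system T) (x : T -> S) B P rho :
  Filter F -> x t @[t --> F] --> B ->
  block_norm2 P rho (x t) @[t --> F] --> block_norm2 P rho B.
Proof.
move=> FF xB; apply: cvg_sumr => -[i j] /=.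
have [E EE] := mxform_innerE (P *m delta_mx i 0) (P *m delta_mx j 0).
have eE Z : (P^T *m mx_of_sym Z *m P) i j = '<<Z, E>>.
  by rewrite -EE mxform_conj mxform_delta.
rewrite eE expr2; under eq_cvg do rewrite eE expr2.
by apply: cvgM; apply: cvg_inner => //; exact: cvg_cst.
Qed.

Lemma spectral_psd_parts G M P rho : psd G -> psd M -> '<<G, M>> = 0 ->
  spectral_decomp (G - M) P rho ->
  mx_of_sym G = P *m diag_mx (\row_i Num.max (rho 0 i) 0) *m P^T /\
  mx_of_sym M = P *m diag_mx (\row_i Num.max (- rho 0 i) 0) *m P^T.
Proof.
move=> G0 M0 GM /metric_proj_spectral[]; have [-> _] := psd_orth G0 M0 GM.
by rewrite opprB addrC subrK.
Qed.

Lemma psdZ c G : 0 <= c -> psd G -> psd (c *: G).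
Proof.
move=> c0 G0; apply/psdE => v.
have -> : mx_of_sym (c *: G) = c *: mx_of_sym G by exact: linearZ.
by rewrite mxformZ mulr_ge0//; exact: G0.
Qed.

Lemma B_subdiff_shifted G M c W : psd G -> psd M -> '<<G, M>> = 0 -> 0 <= c ->
  B_subdiff (metric_proj psd) (M - c *: G) W -> proj_differential M (c *: G) W.
Proof.
move=> G0 M0 GM c0 /B_subdiff_metric_proj.
have cG : '<<M, c *: G>> = 0 by rewrite innerZr innerC GM mulr0.
have [-> _] := psd_orth M0 (psdZ c0 G0) cG.
by rewrite opprB addrC subrK.
Qed.

Lemma proj_differential_block G M c W P rho : psd G -> psd M -> '<<G, M>> = 0 ->
  spectral_decomp (G - M) P rho -> proj_differential M (c *: G) W ->
  forall B, block_norm2 P rho B <= '<<B, W B>>.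
Proof.
move=> G0 M0 GM sd [WE Wfirm _] B.
have [GE ME] := spectral_psd_parts G0 M0 GM sd; have [PP _ _] := sd.
rewrite innerC; apply: le_trans (Wfirm B).
suff -> : block_norm2 P rho B = block_norm2 P rho (W B) by exact: block_norm2_le.
apply: eq_bigr => -[i j] /andP[/= ri rj]; congr (_ ^+ 2).
have := WE B; set Y := mx_of_sym (W B); set b := mx_of_sym B.
have -> : mx_of_sym (c *: G) = c *: mx_of_sym G by exact: linearZ.
rewrite GE ME => /(congr1 (fun T => P^T *m T *m P)).
set a := \row_i Num.max (rho 0 i) 0; set d := \row_i Num.max (- rho 0 i) 0.
have -> : P^T *m (Y *m (c *: (P *m diag_mx a *m P^T)) + P *m diag_mx d *m P^T *m Y) *m P
   = c *: (P^T *m Y *m P *m diag_mx a) + diag_mx d *m (P^T *m Y *m P).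
  rewrite mulmxDr mulmxDl; congr (_ + _).
    by rewrite -!scalemxAr -!scalemxAl !mulmxA -[_ *m P^T *m P]mulmxA PP mulmx1.
  by rewrite !mulmxA PP mul1mx.
have -> : P^T *m (P *m diag_mx d *m P^T *m b) *m P = diag_mx d *m (P^T *m b *m P).
  by rewrite !mulmxA PP mul1mx.
(* The entry reads [c * (y' i j * a_j) + d_i * y' i j = d_i * b' i j], where [a_j = 0] because
   [rho 0 j <= 0] and [d_i = - rho 0 i] is nonzero. *)
move=> /matrixP/(_ i j); rewrite mul_mx_diag !mul_diag_mx.
set y' := P^T *m Y *m P; set b' := P^T *m b *m P.
rewrite 6!mxE /a /d !mxE (max_r rj) !mulr0 add0r max_l ?oppr_ge0 ?ltW//.
by move=> /mulfI -> //; rewrite oppr_eq0 lt_eqF.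
Qed.

End BlockBound.

(** * Uniqueness of the multiplier and definiteness of the operators *)

Section Program.
Context {R : realType} {X : hilbertVectType R} {m p : nat}.
Variables (f : X -> R) (h : X -> evec R m) (g : X -> symmx R p).
Implicit Types (lm : evec R m * symmx R p) (x d : X).

Lemma multipliers_orth x lm : multipliers f h g x lm ->
  [/\ psd (g x), psd lm.2, '<<g x, lm.2>> = 0
    & mx_of_sym lm.2 *m mx_of_sym (g x) = 0].
Proof.
move=> [_ _ g0 m0 mg]; have gm : '<<g x, lm.2>> = 0 by rewrite innerC.
by split=> //; case: (psd_orth m0 g0 mg).
Qed.

(** Stationarity of the Lagrangian and the product form of complementarity are affine in the
    multiplier, so the difference of two multipliers satisfies the homogeneous system that
    nondegeneracy annihilates. *)
Lemma multipliers_unique x lm : is_C2 f -> is_C2 h -> is_C2 g ->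
  constraint_nondegenerate h g x -> multipliers f h g x lm ->
  multipliers f h g x = [set lm].
Proof.
move=> f2 h2 g2 nd lmM; apply/seteqP; split=> [lm' lm'M|_ ->//].
have [gr _ _ _ _] := lmM; have [gr' _ _ _ _] := lm'M.
have [_ _ _ o] := multipliers_orth lmM; have [_ _ _ o'] := multipliers_orth lm'M.
have E lm0 d : grad (lagrangian f h g lm0) x = 0 ->
    '<<lm0.1, jac h x d>> + '<<lm0.2, jac g x d>> = '<<grad f x, d>>.
  move=> gr0; have := grad_lagrangian f2 h2 g2 lm0 x d; rewrite gr0 inner0l.
  by move=> /eqP; rewrite eq_sym -addrA -opprD subr_eq0 eq_sym => /eqP.
have [|| e1 e2] := psd_lineality_nondegenerate nd (z := lm'.1 - lm.1) (Z := lm'.2 - lm.2).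
- by move=> d; rewrite !innerBl addrACA -opprD (E _ d gr) (E _ d gr') subrr.
- have -> : mx_of_sym (lm'.2 - lm.2) = mx_of_sym lm'.2 - mx_of_sym lm.2.
    exact: linearB.
  by rewrite mulmxBl o o' subrr.
move: e1 e2 => /eqP + /eqP; rewrite !subr_eq0 => /eqP e1 /eqP e2.
by rewrite /= [lm']surjective_pairing e1 e2 -surjective_pairing.
Qed.

(** [app] asks for some spectral decomposition; the one fixed in advance serves as witness. *)
Lemma app_block x lm P rho d : spectral_decomp (g x - lm.2) P rho ->
  jac h x d = 0 -> block_norm2 P rho (jac g x d) = 0 -> app h g x lm d.
Proof.
move=> sd hd bd; split=> //; exists P, rho => /=.
have entry i j : rho 0 i < 0 -> rho 0 j <= 0 ->
    (P^T *m mx_of_sym (jac g x d) *m P) i j = 0.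
  move=> ri rj; apply/eqP; rewrite -sqrf_eq0; apply/eqP.
  have sq0 ij : gamma_block rho ij ->
    0 <= (P^T *m mx_of_sym (jac g x d) *m P) ij.1 ij.2 ^+ 2 by rewrite sqr_ge0.
  have /(_ (i, j)) := psumr_eq0P sq0 bd; apply.
  by rewrite /gamma_block/= ri.
have colsE (I J : {set 'I_p}) (A : 'M[R]_p) k l :
    ((cols P I)^T *m A *m cols P J) k l = (P^T *m A *m P) (enum_val k) (enum_val l).
  rewrite /cols !mxE; apply: eq_bigr => j _; rewrite !mxE; congr (_ * _).
  by apply: eq_bigr => i _; rewrite !mxE.
split=> //; apply/matrixP => k l; rewrite colsE [RHS]mxE.
  (* This block has rows in beta and columns in gamma, whereas [gamma_block] puts gamma first:
     symmetry exchanges the indices. *)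
  have := enum_valP k; have := enum_valP l; rewrite !inE => rl /eqP rk.
  have -> : (P^T *m mx_of_sym (jac g x d) *m P) (enum_val k) (enum_val l) =
     (P^T *m mx_of_sym (jac g x d) *m P)^T (enum_val l) (enum_val k) by rewrite [RHS]mxE.
  by rewrite !trmx_mul trmxK mx_of_symT mulmxA entry// rk.
by have := enum_valP k; have := enum_valP l; rewrite !inE => rl rk; rewrite entry// ltW.
Qed.

(** With a single multiplier, [Chat] is [app] and the supremum is its only value; the subtracted
    [Upsilon] is nonnegative. *)
Lemma strong_SOSC_hessian x lm d : strong_SOSC f h g x ->
  multipliers f h g x = [set lm] -> app h g x lm d -> d != 0 ->
  0 < '<<d, hessian (lagrangian f h g lm) x d>>.
Proof.
move=> sosc lmE dapp d0.
have dC : Chat f h g x d by move=> lm'; rewrite lmE => ->.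
have := sosc d dC d0; rewrite lmE image_set1 ereal_sup1 lte_fin subr_gt0.
have lmM : multipliers f h g x lm by rewrite lmE.
have [g0 m0 _ _] := multipliers_orth lmM.
by apply: le_lt_trans; exact: Upsilon_ge0.
Qed.

Lemma AopE (c : R) x lm W d : Aop f h g c x lm W d =
  hessian (lagrangian f h g lm) x d + c *: nabla h x (jac h x d)
  + c *: nabla g x (W (jac g x d)).
Proof. by rewrite /Aop !add_lfunE !scale_lfunE !comp_lfunE. Qed.

Lemma inner_Aop (c : R) x lm W d e : '<<e, Aop f h g c x lm W d>> =
  '<<e, hessian (lagrangian f h g lm) x d>> + c * '<<jac h x e, jac h x d>>
  + c * '<<jac g x e, W (jac g x d)>>.
Proof. by rewrite AopE !innerDr !innerZr /nabla -!adjointP. Qed.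

Lemma Aop_sym (c : R) x lm (W : 'End(symmx R p)) : is_C2 f -> is_C2 h -> is_C2 g ->
  (forall B C, '<<W B, C>> = '<<B, W C>>) ->
  forall d e, '<<d, Aop f h g c x lm W e>> = '<<e, Aop f h g c x lm W d>>.
Proof.
move=> f2 h2 g2 Ws d e; rewrite !inner_Aop.
rewrite -(hessian_lagrangian_sym f2 h2 g2) (innerC (hessian _ _ _)).
by rewrite (innerC (jac h x d)) -Ws (innerC (W _)).
Qed.

Lemma Vop_inner (c : R) x lm (W : 'End(symmx R p)) z z' :
  (forall B C, '<<W B, C>> = '<<B, W C>>) ->
  '<<Vop f h g c x lm W z, z'>> =
  - '<<((Aop f h g c x lm W)^-1)%VF (nabla h x z.1 + nabla g x (W z.2)),
       nabla h x z'.1 + nabla g x (W z'.2)>>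
  - c^-1 * ('<<z.2, z'.2>> - '<<W z.2, z'.2>>).
Proof.
move=> Ws; rewrite VopE/=.
set y := ((Aop f h g c x lm W)^-1)%VF _.
rewrite -[LHS]/('<<- jac h x y - 0, z'.1>> +
  '<<- W (jac g x y) - c^-1 *: (z.2 - W z.2), z'.2>>).
rewrite subr0 innerNl innerBl innerNl innerZl innerBl Ws.
rewrite innerDr /nabla -!adjointP.
by rewrite addrA -opprD.
Qed.

(** Finsler's lemma with [q] the squared violation of the equations of [app]. The lower bound of [W]
    by [block_norm2] is the same for all [W] and [c], hence so are the constants. *)
Lemma Aop_posdef x lm : is_C2 f -> is_C2 h -> is_C2 g ->
  constraint_nondegenerate h g x -> strong_SOSC f h g x ->
  multipliers f h g x lm ->
  exists c0 eta : R, [/\ 0 < c0, 0 < eta & forall c, c0 <= c ->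
    forall W, dBproj g c x lm W ->
    forall d, eta * `|d| ^+ 2 <= '<<d, Aop f h g c x lm W d>>].
Proof.
move=> f2 h2 g2 nd sosc lmM.
have lmE := multipliers_unique f2 h2 g2 nd lmM.
have [g0 m0 gm _] := multipliers_orth lmM.
have [P [rho sd]] := spectral_exists (g x - lm.2).
pose H := hessian (lagrangian f h g lm) x.
pose q d := '<<jac h x d, jac h x d>> + block_norm2 P rho (jac g x d).
have [||||d||c0 [eta [c00 eta0 cP]]] := @finsler R X (fun d => '<<d, H d>>) q.
- by move=> d; apply: cvg_inner; [exact: cvg_id|exact: lfun_continuous].
- move=> d; apply: cvgD.
    by apply: cvg_inner; exact: lfun_continuous.
  by apply: cvg_block_norm2; exact: lfun_continuous.
- by move=> a d; rewrite linearZ innerZl innerZr mulrA -expr2.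
- move=> a d; rewrite /q !linearZ innerZl innerZr block_norm2Z; ring.
- by rewrite addr_ge0 ?inner_ge0 ?block_norm2_ge0.
- move=> d d0 /eqP; rewrite paddr_eq0 ?inner_ge0 ?block_norm2_ge0//.
  move=> /andP[/eqP/inner_eq0 hd /eqP bd].
  exact: (strong_SOSC_hessian sosc lmE (app_block sd hd bd) d0).
exists c0, eta; split=> // c cc0 W WB d.
have c_ge0 : 0 <= c by apply: le_trans cc0; exact: ltW.
have Wd := B_subdiff_shifted g0 m0 gm c_ge0 WB.
apply: le_trans (cP c d cc0) _.
rewrite inner_Aop -addrA lerD2l /q mulrDr lerD2l ler_wpM2l//.
exact: (proj_differential_block g0 m0 gm sd Wd).
Qed.

Lemma Vop_negdef (c : R) x lm (W : 'End(symmx R p)) (eta : R) :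
  is_C2 f -> is_C2 h -> is_C2 g ->
  constraint_nondegenerate h g x -> multipliers f h g x lm ->
  0 < c -> 0 < eta -> proj_differential lm.2 (c *: g x) W ->
  (forall d, eta * `|d| ^+ 2 <= '<<d, Aop f h g c x lm W d>>) ->
  negdef (Vop f h g c x lm W).
Proof.
move=> f2 h2 g2 nd lmM c0 eta0 [WE Wfirm Ws] Apos.
set A := Aop f h g c x lm W in Apos.
pose b (z : evec R m * symmx R p) := nabla h x z.1 + nabla g x (W z.2).
pose y z := (A^-1)%VF (b z).
have A_gt0 d : d != 0 -> 0 < '<<d, A d>>.
  by move=> d0; apply: lt_le_trans (Apos d); rewrite mulr_gt0// exprn_gt0// normr_gt0.
(* A trivial kernel makes the formal inverse in [Vop] a true one. *)
have kerA : lker A == 0%VS.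
  apply/eqP/eqP; rewrite -subv0; apply/subvP => d; rewrite memv_ker => /eqP Ad.
  rewrite memv0; apply: contraT => /A_gt0; by rewrite Ad inner0r ltxx.
have Ay z : A (y z) = b z by exact: lker0_lfunVK.
have VE z z' : '<<Vop f h g c x lm W z, z'>> =
    - '<<y z, A (y z')>> - c^-1 * ('<<z.2, z'.2>> - '<<W z.2, z'.2>>).
  by rewrite Vop_inner// -/A Ay.
split=> [z z'|z z0].
  rewrite VE (innerC z) VE (Aop_sym c x lm f2 h2 g2 Ws) -/A (innerC z.2) Ws.
  by rewrite (innerC z.2 (W _)).
rewrite innerC VE.
(* Firm nonexpansiveness bounds the squared norm of [z.2 - W z.2] by [<z.2, z.2> - <W z.2, z.2>];
   equality with 0 thus means that [W] fixes [z.2]. *)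
have IW := inner_sqrB_le (Wfirm z.2).
have IW0 : 0 <= '<<z.2, z.2>> - '<<W z.2, z.2>> by apply: le_trans IW; exact: inner_ge0.
rewrite -opprD oppr_lt0.
have [y0|/A_gt0 y0] := eqVneq (y z) 0; last first.
  by rewrite ltr_wpDr// mulr_ge0// invr_ge0 ltW.
rewrite y0 inner0l add0r mulr_gt0 ?invr_gt0// lt_neqAle IW0 andbT eq_sym.
apply: contra z0 => /eqP IW00.
have Wz : W z.2 = z.2.
  apply/eqP; rewrite eq_sym -subr_eq0; apply/eqP/inner_eq0/eqP.
  by rewrite eq_le inner_ge0 andbT -IW00.
(* For a fixed point of [W] the terms with [lm.2] on the two sides of [WE] cancel, leaving [c] times
   the product. *)
have zg : mx_of_sym z.2 *m mx_of_sym (g x) = 0.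
  have := WE z.2; rewrite Wz => /eqP; rewrite -subr_eq0 addrK.
  have -> : mx_of_sym (c *: g x) = c *: mx_of_sym (g x) by exact: linearZ.
  by rewrite -scalemxAr scaler_eq0 gt_eqF//= => /eqP.
(* As [y z = 0], also [b z = A 0 = 0]; this is tested against [d], with [W z.2] replaced by
   [z.2]. *)
have bz d : '<<z.1, jac h x d>> + '<<z.2, jac g x d>> = 0.
  have := Ay z; rewrite y0 linear0 => bz.
  rewrite !(innerC z.1) !(innerC z.2) !adjointP -innerDr -Wz.
  by rewrite -[X in '<<d, X>>]/(b z) -bz inner0r.
have [z1 z2] := psd_lineality_nondegenerate nd bz zg.
by rewrite [z]surjective_pairing z1 z2.
Qed.

End Program.

Theorem theorem6p4 (R : realType) (X : hilbertVectType R) (m p : nat)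
    (f : X -> R) (h : X -> evec R m) (g : X -> symmx R p)
    (f_C2 : is_C2 f) (h_C2 : is_C2 h) (g_C2 : is_C2 g)
    (xs : X) (ls : evec R m) (ms : symmx R p)
    (xs_stationary : stationary f h g xs)
    (lms_mult : multipliers f h g xs (ls, ms))
    (xs_nondeg : constraint_nondegenerate h g xs)
    (xs_ssosc : strong_SOSC f h g xs) :
  multipliers f h g xs = [set (ls, ms)] /\
  exists cbar eta : R,
    [/\ 0 < cbar, 0 < eta,
        forall c, cbar <= c ->
          forall W, dBproj g c xs (ls, ms) W ->
          forall x : X, eta * `|x| ^+ 2 <= '<<x, Aop f h g c xs (ls, ms) W x>>
      & forall c, cbar <= c ->
          forall V, Vset f h g c xs (ls, ms) V -> negdef V].
Proof.
split; first exact: multipliers_unique.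
have [cbar [eta [cbar0 eta0 Apos]]] :=
  Aop_posdef f_C2 h_C2 g_C2 xs_nondeg xs_ssosc lms_mult.
exists cbar, eta; split=> // c cc V [W WB <-].
have c0 : 0 < c by exact: lt_le_trans cc.
have [g0 m0 gm _] := multipliers_orth lms_mult.
have Wd := B_subdiff_shifted g0 m0 gm (ltW c0) WB.
exact: (Vop_negdef f_C2 h_C2 g_C2 xs_nondeg lms_mult c0 eta0 Wd (Apos c cc W WB)).
Qed.
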